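(* Let $K$ be a field of characteristic zero, let $n\ge 1$, and let $P_{2n}$ be the free metabelian Poisson algebra over $K$ freely generated by $x_1,\ldots,x_n,y_1,\ldots,y_n$. Let $\delta$ be the derivation of $P_{2n}$ with $\delta(y_i)=x_i$, $\delta(x_i)=0$ for $i=1,\ldots,n$, and let $K\mathcal{B}_4$ be the $K$-linear span of all elements $[z_i,z_j,z_k]\cdot z_l$ with $1\le j<i\le l\le 2n$ and $1\le j\le k<l\le 2n$, where $z_i=x_i$ and $z_{n+i}=y_i$ for $1\le i\le n$. Then the $K$-vector space $(K\mathcal{B}_4)^{\delta}=\{p\in K\mathcal{B}_4:\delta(p)=0\}$ has a basis consisting of the following elements, where all indices range over $\{1,\ldots,n\}$ subject to the indicated conditions. (1) For $j<i\le l$, $j\le k<l$: \[ [x_i,x_j,x_k]\cdot x_l . \] (2) For $j<i$: \[ [x_i,x_j,x_j]\cdot y_j,\qquad [x_i,x_j,x_i]\cdot y_i,\qquad [x_i,x_j,x_i]\cdot y_j+[x_i,x_j,x_j]\cdot y_i . \] (3) For $j<i<k$: \[ [x_i,x_j,x_k]\cdot y_k,\qquad [x_k,x_j,x_i]\cdot y_i,\qquad [x_i,x_j,x_i]\cdot y_k+[x_i,x_j,x_k]\cdot y_i, \] \[ [x_i,x_j,x_i]\cdot y_k+[x_k,x_i,x_i]\cdot y_j,\qquad [x_i,x_j,x_k]\cdot y_j-[x_k,x_j,x_i]\cdot y_j, \] \[ [x_i,x_j,x_k]\cdot y_j+[x_i,x_j,x_j]\cdot y_k,\qquad [x_i,x_j,x_k]\cdot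 y_j+[x_k,x_j,x_j]\cdot y_i, \] \[ [x_k,x_j,x_k]\cdot y_i+[x_k,x_j,x_i]\cdot y_k,\qquad [x_k,x_j,x_k]\cdot y_i-[x_k,x_i,x_k]\cdot y_j . \] (4) For $j<i<k<l$: \[ [x_k,x_j,x_l]\cdot y_i+[x_i,x_j,x_k]\cdot y_l-[x_k,x_i,x_l]\cdot y_j, \] \[ [x_k,x_j,x_i]\cdot y_l-[x_i,x_j,x_k]\cdot y_l+[x_k,x_i,x_l]\cdot y_j, \] \[ [x_l,x_i,x_k]\cdot y_j+[x_i,x_j,x_k]\cdot y_l-[x_k,x_i,x_l]\cdot y_j, \] \[ [x_i,x_j,x_l]\cdot y_k+[x_i,x_j,x_k]\cdot y_l,\qquad [x_l,x_j,x_i]\cdot y_k+[x_k,x_i,x_l]\cdot y_j, \] \[ [x_l,x_j,x_k]\cdot y_i-[x_k,x_i,x_l]\cdot y_j . \] (5) For every $i$: \[ [y_i,x_i,x_i]\cdot y_i . \] (6) For $j<i$: \[ [y_j,x_j,x_i]\cdot y_i,\qquad [y_j,x_i,x_i]\cdot y_i+[y_i,x_j,x_i]\cdot y_i, \] \[ [y_j,x_j,x_i]\cdot y_j+[y_j,x_j,x_j]\cdot y_i,\qquad [y_j,x_i,x_i]\cdot y_j-2[x_i,x_j,y_j]\cdot y_i+[y_i,x_j,x_j]\cdot y_i . \] (7) For $j<i<k$: \[ [y_i,x_j,x_k]\cdot y_i+[x_i,x_j,y_i]\cdot y_k+[x_k,x_i,y_j]\cdot y_i+[y_j,x_i,x_i]\cdot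 y_k, \] \[ [y_j,x_i,x_k]\cdot y_i-[x_i,x_j,y_i]\cdot y_k-[x_k,x_i,y_j]\cdot y_i+[y_i,x_j,x_i]\cdot y_k, \] \[ [x_k,x_j,y_i]\cdot y_k+[x_k,x_i,y_j]\cdot y_k-[y_j,x_k,x_k]\cdot y_i-[y_k,x_j,x_i]\cdot y_k, \] \[ [y_i,x_j,x_k]\cdot y_k+[y_j,x_i,x_k]\cdot y_k,\qquad [y_j,x_j,x_k]\cdot y_i+[y_j,x_j,x_i]\cdot y_k, \] \[ [x_i,x_j,y_j]\cdot y_k+[x_k,x_j,y_j]\cdot y_i-[y_i,x_j,x_j]\cdot y_k-[y_j,x_i,x_k]\cdot y_j . \] (8) For $j<i<k<l$: \[ [x_l,x_k,y_j]\cdot y_i+[x_i,x_j,y_k]\cdot y_l+[y_j,x_i,x_k]\cdot y_l+[y_i,x_j,x_l]\cdot y_k, \] \[ [y_j,x_k,x_l]\cdot y_i+[y_k,x_j,x_i]\cdot y_l-[x_l,x_i,y_j]\cdot y_k-[x_k,x_j,y_i]\cdot y_l, \] \[ [y_j,x_i,x_l]\cdot y_k+[y_i,x_j,x_k]\cdot y_l+[y_j,x_i,x_k]\cdot y_l+[y_i,x_j,x_l]\cdot y_k, \] \[ [x_l,x_j,y_i]\cdot y_k+[x_k,x_i,y_j]\cdot y_l-[y_j,x_i,x_k]\cdot y_l-[y_i,x_j,x_l]\cdot y_k-[x_l,x_i,y_j]\cdot y_k-[x_k,x_j,y_i]\cdot y_l . \]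
   Context: A Poisson algebra over $K$ is a $K$-vector space $P$ with a commutative associative (not necessarily unital) product $\cdot$ and a Lie bracket $[\ ,\ ]$ such that $[a,b\cdot c]=[a,b]\cdot c+[a,c]\cdot b$ for all $a,b,c\in P$. Commutators are left normed: $[a,b,c]=[[a,b],c]$. A Poisson algebra is abelian if $a\cdot b=[a,b]=0$ for all $a,b$, and metabelian if it is an extension of an abelian Poisson algebra by an abelian Poisson algebra; equivalently, it satisfies the identities \[ a\cdot b\cdot c\cdot d=[a\cdot b,c\cdot d]=[[a,b],c\cdot d]=[a,b]\cdot c\cdot d=[a,b]\cdot[c,d]=[[a,b],[c,d]]=0 . \] The free metabelian Poisson algebra $P_{2n}$ is the (non-unital) relatively free algebra of rank $2n$ in the variety of metabelian Poisson algebras, with free generators $x_1,\ldots,x_n,y_1,\ldots,y_n$. A derivation of a Poisson algebra is a linear map satisfying the Leibniz rule for both $\cdot$ and $[\ ,\ ]$; the assignment $\delta(y_i)=x_i$, $\delta(x_i)=0$ extends uniquely to a derivation of $P_{2n}$. *)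

(* Defs.v *)
From HB Require Import structures.
From mathcomp Require Import all_boot all_order all_algebra.

Set Implicit Arguments.
Unset Strict Implicit.
Unset Printing Implicit Defensive.

Import GRing.Theory.
Local Open Scope ring_scope.

HB.mixin Record Lmodule_isPoisson (K : fieldType) P of GRing.Lmodule K P := {
  pmul : P -> P -> P;
  pbr : P -> P -> P;
  pmulA : associative pmul;
  pmulC : commutative pmul;
  pmul_linearr : forall a, linear (pmul a);
  pbr_linearl : forall b, linear (pbr^~ b);
  pbr_linearr : forall a, linear (pbr a);
  pbrxx : forall a, pbr a a = 0;
  pbr_jacobi : forall a b c,
    pbr (pbr a b) c + pbr (pbr b c) a + pbr (pbr c a) b = 0;
  pbr_leibniz : forall a b c,
    pbr a (pmul b c) = pmul (pbr a b) c + pmul (pbr a c) b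
}.

#[short(type="poissonAlgType")]
HB.structure Definition PoissonAlgebra (K : fieldType) :=
  { P of Lmodule_isPoisson K P & GRing.Lmodule K P }.

Declare Scope poisson_scope.
Delimit Scope poisson_scope with PA.
Notation "a ** b" := (pmul a b) (at level 40, left associativity)
  : poisson_scope.
Notation "[< a , b >]" := (pbr a b) (at level 0, format "[< a ,  b >]")
  : poisson_scope.
Notation "[< a , b , c >]" := (pbr (pbr a b) c)
  (at level 0, format "[< a ,  b ,  c >]") : poisson_scope.
Local Open Scope poisson_scope.

Definition poisson_morphism (K : fieldType) (P Q : poissonAlgType K)
    (f : {linear P -> Q}) : Prop :=
  (forall a b, f (a ** b) = f a ** f b) /\
  (forall a b, f [< a, b >] = [< f a, f b >]).

Definition poisson_derivation (K : fieldType) (P : poissonAlgType K)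
    (d : {linear P -> P}) : Prop :=
  (forall a b, d (a ** b) = d a ** b + a ** d b) /\
  (forall a b, d [< a, b >] = [< d a, b >] + [< a, d b >]).

Record poisson_ideal (K : fieldType) (P : poissonAlgType K)
    (I : P -> Prop) : Prop := {
  ideal0 : I 0;
  idealP : forall (c : K) a b, I a -> I b -> I (c *: a + b);
  idealM : forall a b, I a -> I (a ** b);
  idealB : forall a b, I a -> I [< a, b >]
}.

(* The extensions 0 -> I -> P -> P / I -> 0 of abelian algebras by abelian
   algebras: the last clause says that P / I is abelian. *)
Definition metabelian (K : fieldType) (P : poissonAlgType K) : Prop :=
  exists I : P -> Prop,
    [/\ poisson_ideal I,
        forall a b, I a -> I b -> a ** b = 0 /\ [< a, b >] = 0
      & forall a b, I (a ** b) /\ I [< a, b >]].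

(* z freely generates P in the variety of metabelian Poisson algebras. *)
Definition free_metabelian (K : fieldType) (P : poissonAlgType K)
    (T : Type) (z : T -> P) : Prop :=
  metabelian P /\
  forall Q : poissonAlgType K, metabelian Q -> forall u : T -> Q,
    (exists2 f : {linear P -> Q}, poisson_morphism f
                                & forall t, f (z t) = u t) /\
    (forall f g : {linear P -> Q}, poisson_morphism f -> poisson_morphism g ->
       (forall t, f (z t) = u t) -> (forall t, g (z t) = u t) -> f =1 g).

Section LinearAlgebra.
Variables (K : fieldType) (V : lmodType K).

(* Not vector.v's <<_>>, free and basis_of: V may be infinite-dimensional. *)
Definition lin_comb (s : seq V) (c : 'I_(size s) -> K) : V :=
  \sum_(i < size s) c i *: s`_i.

Definition in_span (s : seq V) (v : V) : Prop :=
  exists c : 'I_(size s) -> K, v = lin_comb c.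

Definition lin_indep (s : seq V) : Prop :=
  forall c : 'I_(size s) -> K, lin_comb c = 0 -> forall i, c i = 0.

Definition is_basis (W : V -> Prop) (s : seq V) : Prop :=
  lin_indep s /\ (forall v, W v <-> in_span s v).

End LinearAlgebra.

Definition zgen (T : Type) (n : nat) (x y : 'I_n -> T) (i : 'I_(n + n)) : T :=
  match split i with inl j => x j | inr j => y j end.

Definition B4 (K : fieldType) (P : poissonAlgType K) (N : nat)
    (z : 'I_N -> P) : seq P :=
  [seq (let: (i, j, k, l) := t in [< z i, z j, z k >] ** z l)
  | t : 'I_N * 'I_N * 'I_N * 'I_N <- enum {: 'I_N * 'I_N * 'I_N * 'I_N}
    & let: (i, j, k, l) := t in [&& j < i, i <= l, j <= k & k < l]%N].

(* Increasing index tuples, listed in the order in which the indices are named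
   below: t = (j, i), (j, i, k), (j, i, k, l). *)
Definition incr2 (n : nat) : seq ('I_n * 'I_n) :=
  [seq t : 'I_n * 'I_n <- enum {: 'I_n * 'I_n} | let: (j, i) := t in (j < i)%N].

Definition incr3 (n : nat) : seq ('I_n * 'I_n * 'I_n) :=
  [seq t : 'I_n * 'I_n * 'I_n <- enum {: 'I_n * 'I_n * 'I_n}
  | let: (j, i, k) := t in [&& j < i & i < k]%N].

Definition incr4 (n : nat) : seq ('I_n * 'I_n * 'I_n * 'I_n) :=
  [seq t : 'I_n * 'I_n * 'I_n * 'I_n <- enum {: 'I_n * 'I_n * 'I_n * 'I_n}
  | let: (j, i, k, l) := t in [&& j < i, i < k & k < l]%N].

Section ConstantsBasis.
Variables (K : fieldType) (P : poissonAlgType K) (n : nat) (x y : 'I_n -> P).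

(* constants_yd_m: elements of degree d in the y's and 4 - d in the x's, given by
   m distinct indices. *)
Definition constants_y1_2 : seq P := flatten [seq (let: (j, i) := t in
  [:: [< x i, x j, x j >] ** y j;
      [< x i, x j, x i >] ** y i;
      [< x i, x j, x i >] ** y j + [< x i, x j, x j >] ** y i])
  | t <- incr2 n].

Definition constants_y1_3 : seq P := flatten [seq (let: (j, i, k) := t in
  [:: [< x i, x j, x k >] ** y k;
      [< x k, x j, x i >] ** y i;
      [< x i, x j, x i >] ** y k + [< x i, x j, x k >] ** y i;
      [< x i, x j, x i >] ** y k + [< x k, x i, x i >] ** y j;
      [< x i, x j, x k >] ** y j - [< x k, x j, x i >] ** y j;
      [< x i, x j, x k >] ** y j + [< x i, x j, x j >] ** y k;
      [< x i, x j, x k >] ** y j + [< x k, x j, x j >] ** y i;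
      [< x k, x j, x k >] ** y i + [< x k, x j, x i >] ** y k;
      [< x k, x j, x k >] ** y i - [< x k, x i, x k >] ** y j])
  | t <- incr3 n].

Definition constants_y1_4 : seq P := flatten [seq (let: (j, i, k, l) := t in
  [:: [< x k, x j, x l >] ** y i + [< x i, x j, x k >] ** y l
        - [< x k, x i, x l >] ** y j;
      [< x k, x j, x i >] ** y l - [< x i, x j, x k >] ** y l
        + [< x k, x i, x l >] ** y j;
      [< x l, x i, x k >] ** y j + [< x i, x j, x k >] ** y l
        - [< x k, x i, x l >] ** y j;
      [< x i, x j, x l >] ** y k + [< x i, x j, x k >] ** y l;
      [< x l, x j, x i >] ** y k + [< x k, x i, x l >] ** y j;
      [< x l, x j, x k >] ** y i - [< x k, x i, x l >] ** y j])
  | t <- incr4 n].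

Definition constants_y2_1 : seq P := [seq [< y i, x i, x i >] ** y i | i : 'I_n].

Definition constants_y2_2 : seq P := flatten [seq (let: (j, i) := t in
  [:: [< y j, x j, x i >] ** y i;
      [< y j, x i, x i >] ** y i + [< y i, x j, x i >] ** y i;
      [< y j, x j, x i >] ** y j + [< y j, x j, x j >] ** y i;
      [< y j, x i, x i >] ** y j - 2%:R *: ([< x i, x j, y j >] ** y i)
        + [< y i, x j, x j >] ** y i])
  | t <- incr2 n].

Definition constants_y2_3 : seq P := flatten [seq (let: (j, i, k) := t in
  [:: [< y i, x j, x k >] ** y i + [< x i, x j, y i >] ** y k
        + [< x k, x i, y j >] ** y i + [< y j, x i, x i >] ** y k;
      [< y j, x i, x k >] ** y i - [< x i, x j, y i >] ** y k
        - [< x k, x i, y j >] ** y i + [< y i, x j, x i >] ** y k;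
      [< x k, x j, y i >] ** y k + [< x k, x i, y j >] ** y k
        - [< y j, x k, x k >] ** y i - [< y k, x j, x i >] ** y k;
      [< y i, x j, x k >] ** y k + [< y j, x i, x k >] ** y k;
      [< y j, x j, x k >] ** y i + [< y j, x j, x i >] ** y k;
      [< x i, x j, y j >] ** y k + [< x k, x j, y j >] ** y i
        - [< y i, x j, x j >] ** y k - [< y j, x i, x k >] ** y j])
  | t <- incr3 n].

Definition constants_y2_4 : seq P := flatten [seq (let: (j, i, k, l) := t in
  [:: [< x l, x k, y j >] ** y i + [< x i, x j, y k >] ** y l
        + [< y j, x i, x k >] ** y l + [< y i, x j, x l >] ** y k;
      [< y j, x k, x l >] ** y i + [< y k, x j, x i >] ** y l
        - [< x l, x i, y j >] ** y k - [< x k, x j, y i >] ** y l;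
      [< y j, x i, x l >] ** y k + [< y i, x j, x k >] ** y l
        + [< y j, x i, x k >] ** y l + [< y i, x j, x l >] ** y k;
      [< x l, x j, y i >] ** y k + [< x k, x i, y j >] ** y l
        - [< y j, x i, x k >] ** y l - [< y i, x j, x l >] ** y k
        - [< x l, x i, y j >] ** y k - [< x k, x j, y i >] ** y l])
  | t <- incr4 n].

(* B4 x lists the [x_i, x_j, x_k] . x_l of B4, all killed by the derivation. *)
Definition constants_basis : seq P :=
  B4 x ++ constants_y1_2 ++ constants_y1_3 ++ constants_y1_4
       ++ constants_y2_1 ++ constants_y2_2 ++ constants_y2_3 ++ constants_y2_4.

End ConstantsBasis.

(* The identities defining the variety of metabelian Poisson algebras. *)
Lemma metabelianE (K : fieldType) (P : poissonAlgType K) :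
  metabelian P <->
  forall a b c d : P,
    [/\ a ** b ** c ** d = 0, [< a ** b, c ** d >] = 0
      & [< [< a, b >], c ** d >] = 0] /\
    [/\ [< a, b >] ** c ** d = 0, [< a, b >] ** [< c, d >] = 0
      & [< [< a, b >], [< c, d >] >] = 0].
Proof.
have brC (u v : P) : [< u, v >] = - [< v, u >].
  have h := pbrxx (u + v).
  have addl w1 w2 w : [< w1 + w2, w >] = [< w1, w >] + [< w2, w >] :> P.
    by rewrite -{1}[w1]scale1r (pbr_linearl w 1 w1 w2) scale1r.
  have addr w1 w2 w : [< w, w1 + w2 >] = [< w, w1 >] + [< w, w2 >] :> P.
    by rewrite -{1}[w1]scale1r (pbr_linearr w 1 w1 w2) scale1r.
  move: h; rewrite addl !addr !pbrxx add0r addr0 => /eqP.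
  by rewrite addr_eq0 => /eqP.
split=> [[I [idI abI quoI]] a b c d|idP].
  have M u v : I (u ** v) by case: (quoI u v).
  have B u v : I [< u, v >] by case: (quoI u v).
  split; split; rewrite -1?pmulA.
  - by rewrite !pmulA -pmulA; case: (abI _ _ (M a b) (M c d)).
  - by case: (abI _ _ (M a b) (M c d)).
  - by case: (abI _ _ (B a b) (M c d)).
  - by case: (abI _ _ (B a b) (M c d)).
  - by case: (abI _ _ (B a b) (B c d)).
  - by case: (abI _ _ (B a b) (B c d)).
pose op (g : bool * P * P) : P :=
  if g.1.1 then g.1.2 ** g.2 else [< g.1.2, g.2 >].
pose span v := exists s : seq (K * (bool * P * P)),
  v = \sum_(t <- s) t.1 *: op t.2.
have lin0 (f : P -> P) : linear f -> f 0 = 0.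
  by move=> fl; have := fl (-1) 0 0; rewrite scaler0 addr0 scaleN1r addNr.
have opM g h : op g ** op h = 0.
  case: g h => [[[] a] b] [[[] c] d]; rewrite /op /=.
  - by rewrite pmulA; case: (idP a b c d) => -[].
  - by rewrite pmulC pmulA; case: (idP c d a b) => _ [].
  - by rewrite pmulA; case: (idP a b c d) => _ [].
  - by case: (idP a b c d) => _ [].
have opB g h : [< op g, op h >] = 0.
  case: g h => [[[] a] b] [[[] c] d]; rewrite /op /=.
  - by case: (idP a b c d) => -[].
  - by rewrite brC; case: (idP c d a b) => -[_ _ ->]; rewrite oppr0.
  - by case: (idP a b c d) => -[].
  - by case: (idP a b c d) => _ [].
have lin_sum (f : P -> P) : linear f -> (forall g, f (op g) = 0) ->
    forall v, span v -> f v = 0.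
  move=> fl f0 v [s ->]; elim: s => [|t s IHs]; first by rewrite big_nil lin0.
  by rewrite big_cons fl f0 IHs scaler0 addr0.
have span_op g : span (op g).
  by exists [:: (1, g)]; rewrite big_seq1 scale1r.
have spanM u v : span (u ** v) by exact: (span_op (true, u, v)).
have spanB u v : span [< u, v >] by exact: (span_op (false, u, v)).
exists span; split.
- split=> //; first by exists [::]; rewrite big_nil.
  move=> c _ _ [s ->] [t ->]; exists ([seq (c * w.1, w.2) | w <- s] ++ t).
  rewrite big_cat big_map scaler_sumr; congr (_ + _).
  by apply: eq_bigr => w _; rewrite scalerA.
- move=> a b sa sb; split.
    apply: (lin_sum (pmul a)) => // [|g]; first exact: pmul_linearr.
    rewrite pmulC; apply: (lin_sum (pmul (op g))) => //; exact: pmul_linearr.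
  apply: (lin_sum (pbr a)) => // [|g]; first exact: pbr_linearr.
  apply: (lin_sum (pbr^~ (op g))) => //; exact: pbr_linearl.
- by [].
Qed.

(* Main.v *)
Require Import Defs.
From HB Require Import structures.
From mathcomp Require Import all_boot all_order all_algebra.
From mathcomp Require Import ring zify.

Set Implicit Arguments.
Unset Strict Implicit.
Unset Printing Implicit Defensive.

Import GRing.Theory.
Local Open Scope ring_scope.
Local Open Scope poisson_scope.

(** In a metabelian Poisson algebra the identity [[a, b], c.d] = 0 makes
    [a, b, c].d alternating in c and d.  It is also alternating in a and b and
    satisfies the Jacobi identity in a, b, c, so it has all the symmetries of a
    Riemann curvature tensor; in particular it is unchanged when the pairs
    (a, b) and (c, d) are exchanged (curvature_monomial).  In the free algebra
    there are no further linear relations, so the span of B_4 is the Schur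
    functor S_(2,2) of K^(2n) = K^n (x) K^2, and delta is the raising operator
    of the Lie algebra sl_2 that acts on K^2.  The theorem describes its highest
    weight vectors.

    Everything is computed with formal combinations of words (a, b, c, d), on
    which form v w, the coefficient of v in the Young symmetrisation of w, is a
    symmetric bilinear pairing.  A combination represents 0 in the free algebra
    exactly when it is orthogonal to all words.
    - If it is orthogonal to all words it vanishes under every curvature
      tensor, because 24 F(w) = \sum_v form(v, w) F(v) (sum_null).
    - Conversely w |-> form v w extends to a linear functional on the free
      algebra (extends_form).  An explicit metabelian algebra with two
      generators, where [e1, e2, e1].e2 <> 0, gives the functionals
      (f /\ g)(a, b) (f /\ g)(c, d) for all f and g, and polarising them twice
      gives all the pairings with words.

    Each listed constant is obtained from one of finitely many templates, with
    at most four distinct indices, by an increasing renaming of the indices.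
    The pairing respects the set of indices of a word, and on each index set the
    Gram matrix of the constants is invertible; its inverse yields a dual family
    (dual_constantP).  Pairing a linear relation between the constants with the
    dual family shows that they are independent.

    For the spanning property, let p be in the kernel of delta, with coordinates
    G(v) = <v, p>.  The substitution operator Delta that turns an x_i into y_i
    is the adjoint of delta for the pairing (form_der), hence G vanishes on the
    image of Delta.  By the representation theory of sl_2 each word v is, modulo
    the image of Delta, a combination of the dual constants; this is a finite
    verification for words with at most four indices (defect_null).  So G(v)
    agrees with the coordinate of an explicit combination of the constants
    (dual_expansion), and the two elements are equal because their difference is
    orthogonal to all words. *)

(** * A metabelian Poisson algebra with two generators *)

Section Model.
Variable K : fieldType.

(** The coordinates are: 0 and 1, the generators e1 and e2; 2, [e1, e2];
    3 to 5, the products e1.e1, e1.e2, e2.e2; 6 and 7, the triple brackets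
    [e1, e2, -]; 8 and 9, the space that contains [e1, e2].e_i and
    [e_i.e_j, e_k]; 10, the top degree.  Coordinates 6, 7 and 8, 9 are
    components of linear forms on the span of e1 and e2, which is how they act
    on it to give an element of degree four.

    A name of its own keeps the Poisson structure off the other row vectors. *)
Definition model : Type := 'rV[K]_11.

HB.instance Definition _ := GRing.Lmodule.on model.

Definition mk (s : seq K) : model := \row_i s`_i.
Definition coor (a : model) (k : nat) : K := a 0 (inord k).

Lemma coor_mk s k : (k < 11)%N -> coor (mk s) k = s`_k.
Proof. by move=> k_lt; rewrite /coor mxE inordK. Qed.

Lemma coorD a b k : coor (a + b) k = coor a k + coor b k.
Proof. exact: mxE. Qed.

Lemma coorZ c a k : coor (c *: a) k = c * coor a k.
Proof. exact: mxE. Qed.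

Lemma coor0 k : coor 0 k = 0.
Proof. exact: mxE. Qed.

Lemma modelP (a b : model) :
  (forall k, (k < 11)%N -> coor a k = coor b k) -> a = b.
Proof.
by move=> eq_ab; apply/rowP=> i; have := eq_ab i (ltn_ord i);
  rewrite /coor inord_val.
Qed.

(** With omega(a, b) = a_0 b_1 - a_1 b_0, the form w |-> omega(w, c) is
    [e1, e2].c, and w |-> omega(c, w) is [e1, e2, c]; these opposite signs are
    the alternation of [a, b, c].d in c and d. *)
Definition mul_coords (a b : model) : seq K :=
  let p1 := coor a 0 in let q1 := coor b 0 in
  let p2 := coor a 1 in let q2 := coor b 1 in
  [:: 0; 0; 0; p1 * q1; p1 * q2 + p2 * q1; p2 * q2; 0; 0;
    coor a 2 * q2 + coor b 2 * p2; - (coor a 2 * q1 + coor b 2 * p1);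
    coor a 6 * q1 + coor a 7 * q2 + coor b 6 * p1 + coor b 7 * p2].

(** The action on the products, in coordinates 8 and 9, is forced by the
    Leibniz rule: [b.c, a] is the form
    d |-> omega(a, b) omega(c, d) + omega(a, c) omega(b, d). *)
Definition br_coords (a b : model) : seq K :=
  let p1 := coor a 0 in let q1 := coor b 0 in
  let p2 := coor a 1 in let q2 := coor b 1 in
  [:: 0; 0; p1 * q2 - q1 * p2; 0; 0; 0;
    coor b 2 * p2 - coor a 2 * q2; coor a 2 * q1 - coor b 2 * p1;
    coor a 4 * q2 - 2 * coor a 5 * q1 - (coor b 4 * p2 - 2 * coor b 5 * p1);
    coor a 4 * q1 - 2 * coor a 3 * q2 - (coor b 4 * p1 - 2 * coor b 3 * p2);
    coor a 8 * q1 + coor a 9 * q2 - (coor b 8 * p1 + coor b 9 * p2)].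

Definition model_mul (a b : model) : model := mk (mul_coords a b).
Definition model_br (a b : model) : model := mk (br_coords a b).

Lemma coor_mul k a b :
  (k < 11)%N -> coor (model_mul a b) k = (mul_coords a b)`_k.
Proof. exact: coor_mk. Qed.

Lemma coor_br k a b :
  (k < 11)%N -> coor (model_br a b) k = (br_coords a b)`_k.
Proof. exact: coor_mk. Qed.

(** One call expands one layer of operations: the coordinate of an outer
    product or bracket must be selected before the inner ones are expanded. *)
Ltac model_simpl :=
  rewrite ?(coorD, coorZ, coor0) ?(coor_mul, coor_br) //
          /mul_coords /br_coords /=.

Ltac solve_model :=
  apply: modelP;
  do 11?[case=> [_|]; [do 3?model_simpl; rewrite ?(coorD, coorZ); ring |]];
  by [].

Lemma model_mulA : associative model_mul.
Proof. by move=> a b c; solve_model. Qed.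

Lemma model_mulC : commutative model_mul.
Proof. by move=> a b; solve_model. Qed.

Lemma model_mul_linear a : linear (model_mul a).
Proof. by move=> k b c; solve_model. Qed.

Lemma model_br_linearl b : linear (model_br^~ b).
Proof. by move=> k a c; solve_model. Qed.

Lemma model_br_linearr b : linear (model_br b).
Proof. by move=> k a c; solve_model. Qed.

Lemma model_brxx a : model_br a a = 0.
Proof. by solve_model. Qed.

Lemma model_jacobi a b c : model_br (model_br a b) c
  + model_br (model_br b c) a + model_br (model_br c a) b = 0.
Proof. by solve_model. Qed.

Lemma model_leibniz a b c : model_br a (model_mul b c) =
  model_mul (model_br a b) c + model_mul (model_br a c) b.
Proof. by solve_model. Qed.

HB.instance Definition _ := Lmodule_isPoisson.Build K model
  model_mulA model_mulC model_mul_linear model_br_linearl model_br_linearr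
  model_brxx model_jacobi model_leibniz.

Definition model_gen (p : K * K) : model := mk [:: p.1; p.2].

(** The witness is the ideal of elements without component on e1 and e2. *)
Lemma model_metabelian : metabelian model.
Proof.
exists (fun a => coor a 0 = 0 /\ coor a 1 = 0).
have quotient_abelian (a b : model) :
    (coor (a ** b) 0 = 0 /\ coor (a ** b) 1 = 0)
    /\ (coor [< a, b >] 0 = 0 /\ coor [< a, b >] 1 = 0).
  by rewrite /pmul /pbr /=; model_simpl.
split; [split| |] => //.
- by rewrite !coor0.
- move=> c a b [a0 a1] [b0 b1].
  by rewrite !(coorD, coorZ) a0 a1 b0 b1 mulr0 addr0.
- by move=> a b _; case: (quotient_abelian a b).
- by move=> a b _; case: (quotient_abelian a b).
- move=> a b [a0 a1] [b0 b1]; split; rewrite /pmul /pbr /=; apply: modelP;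
  by do 11?[case=> [_|]; [by model_simpl; rewrite ?a0 ?a1 ?b0 ?b1; ring |]].
Qed.

Definition det2 (p q : K * K) : K := p.1 * q.2 - p.2 * q.1.

(** The algebra realises the curvature tensor omega (x) omega, the square of
    an area form. *)
Lemma model_monomial p1 p2 p3 p4 :
  coor ([< model_gen p1, model_gen p2, model_gen p3 >] ** model_gen p4) 10
  = det2 p1 p2 * det2 p3 p4.
Proof.
rewrite /pmul /pbr /= /det2; do 3?model_simpl.
by rewrite !coor_mk //=; ring.
Qed.
End Model.

(** * Words and curvature tensors *)

(** The letter (b, i) stands for x_i if b is false and for y_i if b is true, and
    the word (a, b, c, d) for the monomial [a, b, c].d. *)
Notation letter := (bool * nat)%type.
Notation word := (letter * letter * letter * letter)%type.
Notation combination := (seq (int * word)).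

Definition letters (w : word) : seq letter :=
  let: (a, b, c, d) := w in [:: a; b; c; d].

Definition fscale (k : int) (q : combination) : combination :=
  [seq (k * cw.1, cw.2) | cw <- q].

(** Symmetrisation of a tensor over the group of order 8 generated by the two
    alternations and the exchange of the pairs. *)
Definition sym8 (a b c d : letter) : combination :=
  [:: (1, (a, b, c, d)); (-1, (b, a, c, d)); (-1, (a, b, d, c));
      (1, (b, a, d, c)); (1, (c, d, a, b)); (-1, (d, c, a, b));
      (-1, (c, d, b, a)); (1, (d, c, b, a))].

(** Removing the totally antisymmetric part of sym8, which is what the Bianchi
    identity asks for, gives 24 times the projection onto curvature tensors. *)
Definition young (w : word) : combination :=
  let: (a, b, c, d) := w in
  fscale 2 (sym8 a b c d) ++ fscale (-1) (sym8 b c a d)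
  ++ fscale (-1) (sym8 c a b d).

(** A recursive function rather than a big operator, because the latter do not
    compute; the same holds for pairing below. *)
Definition coef (v : word) (q : combination) : int :=
  foldr (fun cu s => if v == cu.2 then cu.1 + s else s) 0 q.

Definition form (v w : word) : int := coef v (young w).

(** In a group with 2-torsion the exchange of the pairs and the vanishing on
    repeated letters do not follow from the other symmetries. *)
Record curvature (V : zmodType) (F : word -> V) : Prop := Curvature {
  curv_alt12 : forall a c d, F (a, a, c, d) = 0;
  curv_alt34 : forall a b c, F (a, b, c, c) = 0;
  curv_skew12 : forall a b c d, F (b, a, c, d) = - F (a, b, c, d);
  curv_skew34 : forall a b c d, F (a, b, d, c) = - F (a, b, c, d);
  curv_pair : forall a b c d, F (c, d, a, b) = F (a, b, c, d);
  curv_bianchi : forall a b c d,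
    F (a, b, c, d) + F (b, c, a, d) + F (c, a, b, d) = 0 }.

Definition eval (V : zmodType) (F : word -> V) (q : combination) : V :=
  \sum_(cu <- q) F cu.2 *~ cu.1.

Lemma eval_cat (V : zmodType) (F : word -> V) q1 q2 :
  eval F (q1 ++ q2) = eval F q1 + eval F q2.
Proof. exact: big_cat. Qed.

Lemma eval_scale (V : zmodType) (F : word -> V) k q :
  eval F (fscale k q) = eval F q *~ k.
Proof.
rewrite /eval big_map mulrz_suml; apply: eq_bigr => cu _.
by rewrite mulrC mulrzA.
Qed.

(** A curvature tensor is fixed by the projection onto curvature tensors. *)
Lemma eval_young (V : zmodType) (F : word -> V) w : curvature F ->
  eval F (young w) = F w *+ 24.
Proof.
case=> _ _ s12 s34 pr bi; case: w => [[[a b] c] d].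
have sum8 a' b' c' d' :
    eval F (sym8 a' b' c' d') = F (a', b', c', d') *+ 8.
  rewrite /eval !big_cons big_nil /=.
  rewrite (s12 c' d' a') (s12 c' d' b') (s34 c' d' a').
  rewrite (pr a' b' c' d') (s12 a' b' c') (s12 a' b' d') (s34 a' b' c').
  by rewrite !mulrN1z !mulr1z !opprK !mulrS addr0.
rewrite /young !eval_cat !eval_scale !sum8 /=.
have -> : F (a, b, c, d) *+ 24
    = F (a, b, c, d) *+ 8 *~ 2 + F (a, b, c, d) *+ 8
  by rewrite -[_ *~ 2]/(_ *+ 2) -mulrnA -mulrnDr.
congr (_ + _); rewrite !mulrN1z -opprD -mulrnDl -mulNrn; congr (_ *+ _).
by apply/eqP; rewrite eq_sym -subr_eq0 opprK addrA bi.
Qed.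

Lemma coefE v q : coef v q = \sum_(cu <- q) cu.1 * (v == cu.2)%:R.
Proof.
elim: q => [|cu q IHq] /=; first by rewrite big_nil.
by rewrite big_cons -IHq; case: eqP => _; rewrite (mulr1, mulr0) ?add0r.
Qed.

(** In this order of arguments kron a is the coordinate function of the letter
    a, which can be replaced by other functions in form_columns. *)
Definition kron (a p : letter) : int := (p == a)%:R.

(** The pairing as a polynomial in 2 x 2 minors.  The columns A, B, C, D are
    arbitrary functions, so that it also gives the effect of replacing a letter
    by a sum of letters. *)
Definition form_columns (p q r s : letter) (A B C D : letter -> int) : int :=
  let m X Y Z T := (X p * Y q - Y p * X q) * (Z r * T s - T r * Z s)
                 + (Z p * T q - T p * Z q) * (X r * Y s - Y r * X s) in
  2 * m A B C D - m B C A D - m C A B D.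

Lemma formE p q r s a b c d :
  form (p, q, r, s) (a, b, c, d)
  = form_columns p q r s (kron a) (kron b) (kron c) (kron d).
Proof.
have eq4 a' b' c' d' : ((p, q, r, s) == (a', b', c', d'))%:R
    = kron a' p * kron b' q * kron c' r * kron d' s :> int.
  by rewrite /eq_op /= /eq_op /= /kron /eq_op /= -!natrM !mulnb.
rewrite /form coefE /young !big_cat !big_map /= !big_cons !big_nil /= !eq4.
by rewrite /form_columns; ring.
Qed.

Lemma kronC a p : kron a p = kron p a.
Proof. by rewrite /kron eq_sym. Qed.

(** The projection onto curvature tensors is orthogonal. *)
Lemma formC v w : form v w = form w v.
Proof.
case: v w => [[[p q] r] s] [[[a b] c] d]; rewrite !formE /form_columns.
rewrite (kronC p a) (kronC p b) (kronC p c) (kronC p d).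
rewrite (kronC q a) (kronC q b) (kronC q c) (kronC q d).
rewrite (kronC r a) (kronC r b) (kronC r c) (kronC r d).
rewrite (kronC s a) (kronC s b) (kronC s c) (kronC s d).
ring.
Qed.

Lemma form_curvature v : curvature (form v).
Proof.
by case: v => [[[p q] r] s]; split=> *; rewrite !formE /form_columns; ring.
Qed.

(** * Straightening into standard words *)

(** The order z_1 < ... < z_(2n) in which the x's come before the y's. *)
Definition llt (a b : letter) : bool :=
  if a.1 == b.1 then (a.2 < b.2)%N else b.1.

Variant letter_compare (a b : letter) : bool -> bool -> Prop :=
  | LetterLt of llt a b : letter_compare a b true false
  | LetterGt of llt b a : letter_compare a b false true
  | LetterEq of a = b : letter_compare a b false false.

Lemma lltP a b : letter_compare a b (llt a b) (llt b a).
Proof.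
case: a b => [[] i] [[] j]; rewrite /llt /=; try by constructor.
- by case: ltngtP => [||->]; constructor.
- by case: ltngtP => [||->]; constructor.
Qed.

Lemma llt_trans b a c : llt a b -> llt b c -> llt a c.
Proof.
by case: a b c => [[] i] [[] j] [[] k] //; rewrite /llt /=; apply: ltn_trans.
Qed.

Lemma lltxx a : llt a a = false.
Proof. by rewrite /llt eqxx ltnn. Qed.

Lemma lltN a b : llt a b -> llt b a = false.
Proof. by case: lltP. Qed.

(** Words of the shape that occurs in B_4, namely j < i <= l and j <= k < l:
    the semistandard tableaux with columns (j, i) and (k, l). *)
Definition sst (w : word) : bool :=
  let: (i, j, k, l) := w in
  [&& llt j i, ~~ llt l i, ~~ llt k j & llt k l].

(** For columns j < i, k < l with j <= k, the only obstruction to being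
    standard is l < i.  Then the Bianchi identity gives
    F(i, j, k, l) = F(l, j, k, i) - F(k, j, l, i), and if j = k the exchange of
    the columns suffices. *)
Definition straight_sorted (i j k l : letter) : combination :=
  if ~~ llt l i then [:: (1, (i, j, k, l))]
  else if llt j k then [:: (1, (l, j, k, i)); (-1, (k, j, l, i))]
  else [:: (1, (l, k, j, i))].

Definition straight_columns (i j k l : letter) : combination :=
  if llt k j then straight_sorted l k j i else straight_sorted i j k l.

Definition straight (w : word) : combination :=
  let: (a, b, c, d) := w in
  if (a == b) || (c == d) then [::]
  else match llt b a, llt c d with
  | true, true => straight_columns a b c d
  | true, false => fscale (-1) (straight_columns a b d c)
  | false, true => fscale (-1) (straight_columns b a c d)
  | false, false => straight_columns b a d c
  end.

Section Straighten.
Variables (V : zmodType) (F : word -> V).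
Hypothesis curvF : curvature F.

Lemma eval_straight_sorted i j k l :
  eval F (straight_sorted i j k l) = F (i, j, k, l).
Proof.
have [_ _ s12 s34 pr bi] := curvF.
rewrite /eval /straight_sorted; case: ifP => _.
  by rewrite big_seq1 mulr1z.
case: ifP => _; last first.
  by rewrite big_seq1 mulr1z (s12 k l j) (s34 k l i) opprK pr.
rewrite !big_cons big_nil /= mulrN1z mulr1z addr0; apply/eqP.
have /eqP := bi j k l i; rewrite -(pr k l) (s12 i j) (s12 k j).
by rewrite addrAC addr_eq0 opprK addrC.
Qed.

Lemma eval_straight w : eval F (straight w) = F w.
Proof.
have [a12 a34 s12 s34 pr bi] := curvF.
have colE i j k l : eval F (straight_columns i j k l) = F (i, j, k, l).
  rewrite /straight_columns; case: ifP => _; rewrite eval_straight_sorted //.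
  by rewrite (s12 k l j) (s34 k l i) opprK pr.
case: w => [[[a b] c] d] /=; case: ifP => [/orP[/eqP->|/eqP->]|_].
- by rewrite /eval big_nil a12.
- by rewrite /eval big_nil a34.
case: (llt b a); case: (llt c d); rewrite ?eval_scale colE ?mulrN1z //.
by rewrite (s12 a b d c) (s34 a b c d) opprK.
Qed.
End Straighten.

Lemma straight_sst (A : pred letter) w : all A (letters w) ->
  all (fun cu => sst cu.2 && all A (letters cu.2)) (straight w).
Proof.
have sorted_ok i j k l : all A [:: i; j; k; l] ->
    llt j i -> llt k l -> ~~ llt k j ->
    all (fun cu => sst cu.2 && all A (letters cu.2)) (straight_sorted i j k l).
  case/and5P=> Ai Aj Ak Al _ lt_ji lt_kl le_jk; rewrite /straight_sorted.
  case: ifP => [le_il|/negbFE lt_li].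
    by rewrite /= lt_ji le_il le_jk lt_kl Ai Aj Ak Al.
  have lt_ki := llt_trans lt_kl lt_li.
  case: (lltP j k) le_jk lt_kl lt_ki => // [lt_jk|<-] _ lt_kl lt_ki /=;
    rewrite Ai Aj ?Ak Al.
    have lt_jl := llt_trans lt_jk lt_kl.
    rewrite lt_jl lt_jk lt_ki lt_li.
    by rewrite ?(lltN lt_jk, lltN lt_li, lltN lt_ki, lltN lt_jl).
  by rewrite lt_kl lt_ki (lltN lt_li) lltxx.
have columns_ok i j k l : all A [:: i; j; k; l] -> llt j i -> llt k l ->
    all (fun cu => sst cu.2 && all A (letters cu.2)) (straight_columns i j k l).
  move=> Aw lt_ji lt_kl; rewrite /straight_columns; case: ifP => lt_kj.
    apply: sorted_ok => //; last by rewrite lltN.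
    by case/and5P: Aw => /= -> -> -> ->.
  by apply: sorted_ok => //; rewrite lt_kj.
case: w => [[[a b] c] d] /and5P[Aa Ab Ac Ad _] /=.
have scale_ok k q : all (fun cu => sst cu.2 && all A (letters cu.2)) q ->
    all (fun cu => sst cu.2 && all A (letters cu.2)) (fscale k q).
  by rewrite all_map.
case: eqP => // neq_ab; case: eqP => //= neq_cd.
case: (lltP b a) => [lt_ba|lt_ab|/esym//]; case: (lltP c d) => [lt_cd|lt_dc|//];
  by [apply: columns_ok => //=; rewrite Aa Ab Ac Ad
     | apply: scale_ok; apply: columns_ok => //=; rewrite Aa Ab Ac Ad].
Qed.

(** A linear property of the values of a curvature tensor has to be checked
    on standard words only.  The predicate A records that straightening
    introduces no new letters. *)
Lemma straighten_in (V : zmodType) (F : word -> V) (S : V -> Prop)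
    (A : pred letter) : curvature F -> S 0 ->
  (forall u v, S u -> S v -> S (u - v)) ->
  (forall w, sst w -> all A (letters w) -> S (F w)) ->
  forall w, all A (letters w) -> S (F w).
Proof.
move=> curvF S0 SB Ssst w Aw.
have SN u : S u -> S (- u) by rewrite -(sub0r u); apply: SB.
have SD u v : S u -> S v -> S (u + v).
  by move=> Su Sv; rewrite -(opprK v); apply/SB/SN.
rewrite -(eval_straight curvF) /eval big_seq.
apply: (big_ind S) => // cu /(allP (straight_sst Aw))/andP[sst_u Au].
have Sn n : S (F cu.2 *+ n).
  by elim: n => // n IHn; rewrite mulrS; apply: SD => //; apply: Ssst.
by case: (cu.1) => n; [exact: Sn | rewrite NegzE mulrNz; exact/SN/Sn].
Qed.

Fixpoint insert_term (t : int * word) (q : combination) : combination :=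
  if q is u :: q' then
    if u.2 == t.2 then (u.1 + t.1, u.2) :: q' else u :: insert_term t q'
  else [:: t].

(** Straightened combination with the coefficients of equal words added up:
    a computable normal form. *)
Definition collect (q : combination) : combination :=
  foldr (fun cw s => foldr insert_term s (fscale cw.1 (straight cw.2))) [::] q.

Definition is_null (q : combination) : bool :=
  all (fun cu => cu.1 == 0) (collect q).

(** The normal form decides whether a combination vanishes under all
    curvature tensors, in particular after any renaming of letters. *)
Lemma eval_null (V : zmodType) (F : word -> V) q :
  curvature F -> is_null q -> eval F q = 0.
Proof.
move=> curvF null_q.
have insE t s : eval F (insert_term t s) = F t.2 *~ t.1 + eval F s.
  elim: s => [|u s IHs] /=; first by rewrite /eval big_seq1 big_nil addr0.
  case: eqP => [ <-|_]; rewrite /eval !big_cons /= ?mulrzDr.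
    by rewrite (addrC (_ *~ u.1)) addrA.
  by rewrite [X in _ + X]IHs addrCA.
have insallE s t : eval F (foldr insert_term s t) = eval F t + eval F s.
  elim: t => [|u t IHt] /=; first by rewrite [eval F [::]]big_nil add0r.
  by rewrite insE IHt [eval F (_ :: _)]big_cons addrA.
have <- : eval F (collect q) = eval F q.
  elim: q {null_q} => // t q IHq; rewrite insallE IHq eval_scale.
  by rewrite eval_straight // [RHS]big_cons.
rewrite /eval big_seq big1 // => cu /(allP null_q)/eqP ->.
exact: mulr0z.
Qed.

(** * The raising and lowering derivations *)

(** For b true this is delta on letters: y_i becomes x_i and x_i becomes 0.
    For b false it is the opposite substitution Delta. *)
Definition flip (b : bool) (a : letter) : seq letter :=
  if a.1 == b then [:: (~~ b, a.2)] else [::].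

Definition word_der (b : bool) (w : word) : seq word :=
  let: (p, q, r, s) := w in
  [seq (p', q, r, s) | p' <- flip b p] ++ [seq (p, q', r, s) | q' <- flip b q]
  ++ [seq (p, q, r', s) | r' <- flip b r]
  ++ [seq (p, q, r, s') | s' <- flip b s].

(** The matrix of the substitution on letters, in the place of the identity
    matrix kron. *)
Definition kronD (b : bool) (a p : letter) : int :=
  \sum_(a' <- flip b a) kron a' p.

Lemma kronDC b a p : kronD b a p = kronD (~~ b) p a.
Proof.
case: a p => [[] i] [[] j]; rewrite /kronD /flip; case: b => /=;
  by rewrite ?big_nil ?big_seq1 /kron ?xpair_eqE //= eq_sym.
Qed.

Lemma sum_form_word_der b p q r s a1 a2 a3 a4 :
  \sum_(u <- word_der b (a1, a2, a3, a4)) form (p, q, r, s) u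
  = form_columns p q r s (kronD b a1) (kron a2) (kron a3) (kron a4)
  + (form_columns p q r s (kron a1) (kronD b a2) (kron a3) (kron a4)
  + (form_columns p q r s (kron a1) (kron a2) (kronD b a3) (kron a4)
  + form_columns p q r s (kron a1) (kron a2) (kron a3) (kronD b a4))).
Proof.
rewrite /word_der !big_cat !big_map /=; congr (_ + (_ + (_ + _)));
  rewrite /form_columns /kronD /flip; case: ifP => _;
  rewrite ?big_seq1 ?big_nil ?formE ?/form_columns //; by ring.
Qed.

(** The two substitutions are transposes of each other on letters (kronDC),
    and the pairing is built from the standard pairing of letters, so the two
    derivations are adjoint. *)
Lemma form_der b v w :
  \sum_(u <- word_der b w) form v u = \sum_(u <- word_der (~~ b) v) form u w.
Proof.
under [RHS]eq_bigr do rewrite formC.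
case: v w => [[[p q] r] s] [[[a1 a2] a3] a4].
rewrite !sum_form_word_der /form_columns.
rewrite (kronC p a1) (kronC p a2) (kronC p a3) (kronC p a4).
rewrite (kronC q a1) (kronC q a2) (kronC q a3) (kronC q a4).
rewrite (kronC r a1) (kronC r a2) (kronC r a3) (kronC r a4).
rewrite (kronC s a1) (kronC s a2) (kronC s a3) (kronC s a4).
rewrite !(kronDC (~~ b)) negbK.
ring.
Qed.

(** * Constants with at most four indices *)

(** The listed constants with m distinct indices, in the order of the list and
    with the indices numbered increasingly from 0.  For m > 1 they are preceded
    by the elements of B_4 in the x's alone that have exactly m distinct
    indices, one for m = 2, three for m = 3 and two for m = 4. *)
Definition templates (m : nat) : seq combination :=
  let x k := (false, k) in let y k := (true, k) in
  match m with
  | 1 => let i := 0%N in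
    [:: [:: (1, (y i, x i, x i, y i))]]
  | 2 => let j := 0%N in let i := 1%N in
    [:: [:: (1, (x i, x j, x j, x i))];
        [:: (1, (x i, x j, x j, y j))];
        [:: (1, (x i, x j, x i, y i))];
        [:: (1, (x i, x j, x i, y j)); (1, (x i, x j, x j, y i))];
        [:: (1, (y j, x j, x i, y i))];
        [:: (1, (y j, x i, x i, y i)); (1, (y i, x j, x i, y i))];
        [:: (1, (y j, x j, x i, y j)); (1, (y j, x j, x j, y i))];
        [:: (1, (y j, x i, x i, y j)); (-2, (x i, x j, y j, y i));
            (1, (y i, x j, x j, y i))]]
  | 3 => let j := 0%N in let i := 1%N in let k := 2%N in
    [:: [:: (1, (x i, x j, x j, x k))];
        [:: (1, (x i, x j, x i, x k))];
        [:: (1, (x k, x j, x i, x k))];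
        [:: (1, (x i, x j, x k, y k))];
        [:: (1, (x k, x j, x i, y i))];
        [:: (1, (x i, x j, x i, y k)); (1, (x i, x j, x k, y i))];
        [:: (1, (x i, x j, x i, y k)); (1, (x k, x i, x i, y j))];
        [:: (1, (x i, x j, x k, y j)); (-1, (x k, x j, x i, y j))];
        [:: (1, (x i, x j, x k, y j)); (1, (x i, x j, x j, y k))];
        [:: (1, (x i, x j, x k, y j)); (1, (x k, x j, x j, y i))];
        [:: (1, (x k, x j, x k, y i)); (1, (x k, x j, x i, y k))];
        [:: (1, (x k, x j, x k, y i)); (-1, (x k, x i, x k, y j))];
        [:: (1, (y i, x j, x k, y i)); (1, (x i, x j, y i, y k));
            (1, (x k, x i, y j, y i)); (1, (y j, x i, x i, y k))];
        [:: (1, (y j, x i, x k, y i)); (-1, (x i, x j, y i, y k));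
            (-1, (x k, x i, y j, y i)); (1, (y i, x j, x i, y k))];
        [:: (1, (x k, x j, y i, y k)); (1, (x k, x i, y j, y k));
            (-1, (y j, x k, x k, y i)); (-1, (y k, x j, x i, y k))];
        [:: (1, (y i, x j, x k, y k)); (1, (y j, x i, x k, y k))];
        [:: (1, (y j, x j, x k, y i)); (1, (y j, x j, x i, y k))];
        [:: (1, (x i, x j, y j, y k)); (1, (x k, x j, y j, y i));
            (-1, (y i, x j, x j, y k)); (-1, (y j, x i, x k, y j))]]
  | 4 => let j := 0%N in let i := 1%N in let k := 2%N in let l := 3%N in
    [:: [:: (1, (x i, x j, x k, x l))];
        [:: (1, (x k, x j, x i, x l))];
        [:: (1, (x k, x j, x l, y i)); (1, (x i, x j, x k, y l));
            (-1, (x k, x i, x l, y j))];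
        [:: (1, (x k, x j, x i, y l)); (-1, (x i, x j, x k, y l));
            (1, (x k, x i, x l, y j))];
        [:: (1, (x l, x i, x k, y j)); (1, (x i, x j, x k, y l));
            (-1, (x k, x i, x l, y j))];
        [:: (1, (x i, x j, x l, y k)); (1, (x i, x j, x k, y l))];
        [:: (1, (x l, x j, x i, y k)); (1, (x k, x i, x l, y j))];
        [:: (1, (x l, x j, x k, y i)); (-1, (x k, x i, x l, y j))];
        [:: (1, (x l, x k, y j, y i)); (1, (x i, x j, y k, y l));
            (1, (y j, x i, x k, y l)); (1, (y i, x j, x l, y k))];
        [:: (1, (y j, x k, x l, y i)); (1, (y k, x j, x i, y l));
            (-1, (x l, x i, y j, y k)); (-1, (x k, x j, y i, y l))];
        [:: (1, (y j, x i, x l, y k)); (1, (y i, x j, x k, y l));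
            (1, (y j, x i, x k, y l)); (1, (y i, x j, x l, y k))];
        [:: (1, (x l, x j, y i, y k)); (1, (x k, x i, y j, y l));
            (-1, (y j, x i, x k, y l)); (-1, (y i, x j, x l, y k));
            (-1, (x l, x i, y j, y k)); (-1, (x k, x j, y i, y l))]]
  | _ => [::]
  end.

(** The nonzero entries of 36 times the inverse of the Gram matrix of the
    templates; 36 clears the denominators for all m. *)
Definition dual_coefs (m : nat) : seq (seq (int * nat)) :=
  match m with
  | 1 => [::
      [:: (6, 0%N)]]
  | 2 => [::
      [:: (6, 0%N)];
      [:: (12, 1%N)];
      [:: (12, 2%N)];
      [:: (6, 3%N)];
      [:: (20, 4%N); (2, 7%N)];
      [:: (6, 5%N)];
      [:: (6, 6%N)];
      [:: (2, 4%N); (2, 7%N)]]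
  | 3 => [::
      [:: (12, 0%N)];
      [:: (12, 1%N)];
      [:: (12, 2%N)];
      [:: (21, 3%N); (-6, 10%N); (3, 11%N)];
      [:: (21, 4%N); (-6, 5%N); (3, 6%N)];
      [:: (-6, 4%N); (12, 5%N); (-6, 6%N)];
      [:: (3, 4%N); (-6, 5%N); (9, 6%N)];
      [:: (21, 7%N); (-3, 8%N); (-3, 9%N)];
      [:: (-3, 7%N); (9, 8%N); (-3, 9%N)];
      [:: (-3, 7%N); (-3, 8%N); (9, 9%N)];
      [:: (-6, 3%N); (12, 10%N); (-6, 11%N)];
      [:: (3, 3%N); (-6, 10%N); (9, 11%N)];
      [:: (4, 12%N); (2, 13%N)];
      [:: (2, 12%N); (10, 13%N)];
      [:: (4, 14%N); (-2, 15%N)];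
      [:: (-2, 14%N); (10, 15%N)];
      [:: (10, 16%N); (-2, 17%N)];
      [:: (-2, 16%N); (4, 17%N)]]
  | 4 => [::
      [:: (24, 0%N); (-12, 1%N)];
      [:: (-12, 0%N); (24, 1%N)];
      [:: (18, 2%N); (3, 3%N); (-6, 4%N); (-6, 5%N); (3, 6%N); (-9, 7%N)];
      [:: (3, 2%N); (18, 3%N); (3, 4%N); (3, 5%N); (-6, 6%N); (3, 7%N)];
      [:: (-6, 2%N); (3, 3%N); (18, 4%N); (-6, 5%N); (3, 6%N); (3, 7%N)];
      [:: (-6, 2%N); (3, 3%N); (-6, 4%N); (18, 5%N); (-9, 6%N); (3, 7%N)];
      [:: (3, 2%N); (-6, 3%N); (3, 4%N); (-9, 5%N); (18, 6%N); (3, 7%N)];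
      [:: (-9, 2%N); (3, 3%N); (3, 4%N); (3, 5%N); (3, 6%N); (18, 7%N)];
      [:: (8, 8%N); (-4, 9%N); (-4, 10%N); (2, 11%N)];
      [:: (-4, 8%N); (8, 9%N); (2, 10%N); (-4, 11%N)];
      [:: (-4, 8%N); (2, 9%N); (8, 10%N); (2, 11%N)];
      [:: (2, 8%N); (-4, 9%N); (2, 10%N); (8, 11%N)]]
  | _ => [::]
  end.

Definition dual_template (m r : nat) : combination :=
  flatten [seq fscale c.1 (nth [::] (templates m) c.2)
          | c <- nth [::] (dual_coefs m) r].

Definition indices (w : word) : seq nat := [seq a.2 | a <- letters w].

(** Sorted and without repetition, so that it is the increasing tuple of
    indices by which templates are renamed. *)
Definition support (w : word) : seq nat := sort leq (undup (indices w)).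

Definition pairing (q : combination) (w : word) : int :=
  foldr (fun cu s => cu.1 * form cu.2 w + s) 0 q.

Definition der (b : bool) (q : combination) : combination :=
  flatten [seq [seq (cu.1, u) | u <- word_der b cu.2] | cu <- q].

Definition ydeg (w : word) : nat := count (fun a => a.1) (letters w).

(** A combination q for which 12 v - Delta q is 12 times the projection of v to
    the highest weight vectors.  A word with d letters y has weight 4 - 2d.  On
    an irreducible component of highest weight mu, a vector of weight mu - 2k is
    multiplied by k (mu - k + 1) under Delta delta, and 4, 2 and 0 are the only
    possible mu.  Solving for the coefficients of Delta delta and
    Delta^2 delta^2, with d = 0, ..., 4, gives the two lists.  For d > 2 there
    are no highest weight vectors and 12 v = Delta q. *)
Definition lowering (v : word) : combination :=
  let up := der true in let down := der false in
  let q := up [:: (1, v)] in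
  fscale [:: 0; 3; 6; 8; 3]`_(ydeg v) q
  ++ fscale [:: 0; 0; -1; -1; 0]`_(ydeg v) (down (up q)).

(** 12 * 36 times the difference between v and its expansion, modulo the image
    of Delta, in the dual templates. *)
Definition defect (m : nat) (v : word) : combination :=
  fscale (12 * 36) [:: (1, v)]
  ++ fscale (-36) (der false (lowering v))
  ++ flatten [seq fscale (-12 * pairing (nth [::] (templates m) r) v)
                         (dual_template m r)
             | r <- iota 0 (size (templates m))].

Definition local_letters (m : nat) : seq letter :=
  [seq (b, i) | b <- [:: false; true], i <- iota 0 m].

Definition sst_words (m : nat) : seq word :=
  let L := local_letters m in
  [seq w <- [seq (ab.1, ab.2, cd.1, cd.2)
            | ab <- [seq (a, b) | a <- L, b <- L],
              cd <- [seq (c, d) | c <- L, d <- L]]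
  | sst w & support w == iota 0 m].

Definition ranks : seq nat := [:: 1; 2; 3; 4]%N.

Lemma templates_constant :
  all (fun m => all (fun q => is_null (der true q)) (templates m)) ranks.
Proof. by vm_compute. Qed.

Lemma templates_support :
  all (fun m => all (all (fun cu => support cu.2 == iota 0 m)) (templates m))
      ranks.
Proof. by vm_compute. Qed.

Lemma dual_template_support :
  all (fun m => all (fun r =>
    all (fun cu => support cu.2 == iota 0 m) (dual_template m r))
  (iota 0 (size (templates m)))) ranks.
Proof. by vm_compute. Qed.

Lemma dual_templates :
  all (fun m => all (fun r => all (fun s =>
    \sum_(cu <- nth [::] (templates m) s)
        cu.1 * pairing (dual_template m r) cu.2
      == 36 * (r == s)%:R)
   (iota 0 (size (templates m)))) (iota 0 (size (templates m)))) ranks.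
Proof.
(* The big operators are opaque, hence stuck until unlocked. *)
by rewrite unlock; vm_compute.
Qed.

Lemma defect_null :
  all (fun m => all (fun v => is_null (defect m v)) (sst_words m)) ranks.
Proof. by vm_compute. Qed.

(** * Increasing renamings of the indices *)

Lemma letters_young w :
  all (fun cu => perm_eq (letters cu.2) (letters w)) (young w).
Proof.
case: w => [[[a b] c] d]; rewrite /young /=.
by do 24!(rewrite [perm_eq _ _](introT seq.permP) /=;
  [|by move=> p /=; lia]).
Qed.

Lemma support_perm v w :
  perm_eq (letters v) (letters w) -> support v = support w.
Proof.
move=> /(perm_map snd) pvw; apply/perm_sortP.
- exact: leq_total.
- exact: leq_trans.
- exact: anti_leq.
- apply: uniq_perm; rewrite ?undup_uniq // => i.
  by rewrite !mem_undup; exact: perm_mem.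
Qed.

(** The symmetrisation of a word only permutes its letters. *)
Lemma form_support v w : support v != support w -> form v w = 0.
Proof.
move=> neq_vw; rewrite /form coefE big_seq big1 // => cu.
move=> /(allP (letters_young w))/support_perm eq_uw.
by case: (v =P cu.2) neq_vw => [->|_]; rewrite ?eq_uw ?eqxx // mulr0.
Qed.

Definition rename_letter (t : seq nat) (a : letter) : letter :=
  (a.1, nth 0%N t a.2).

Definition rename_word (t : seq nat) (w : word) : word :=
  let: (a, b, c, d) := w in
  (rename_letter t a, rename_letter t b, rename_letter t c, rename_letter t d).

Definition rename (t : seq nat) (q : combination) : combination :=
  [seq (cu.1, rename_word t cu.2) | cu <- q].

Lemma eval_rename (V : zmodType) (F : word -> V) t q :
  eval F (rename t q) = eval (F \o rename_word t) q.
Proof. exact: big_map. Qed.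

Lemma curvature_rename (V : zmodType) (F : word -> V) t :
  curvature F -> curvature (F \o rename_word t).
Proof. by case=> a12 a34 s12 s34 pr bi; split=> * /=. Qed.

Lemma word_der_rename b t w :
  word_der b (rename_word t w) = [seq rename_word t u | u <- word_der b w].
Proof.
case: w => [[[p q] r] s]; rewrite /word_der !map_cat /=.
by rewrite /flip /=; do 4!case: ifP => _.
Qed.

Lemma der_rename b t q : der b (rename t q) = rename t (der b q).
Proof.
elim: q => // cu q IHq; rewrite /der /= -/(der _ _) [der _ _]IHq.
by rewrite word_der_rename [RHS]map_cat -!map_comp.
Qed.

Lemma eval_der (V : zmodType) (F : word -> V) b q :
  eval F (der b q) = eval (fun w => \sum_(u <- word_der b w) F u) q.
Proof.
rewrite /eval big_flatten big_map; apply: eq_bigr => cu _.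
by rewrite big_map mulrz_suml.
Qed.

Lemma indices_rename t w :
  indices (rename_word t w) = [seq nth 0%N t i | i <- indices w].
Proof. by case: w => [[[a b] c] d]. Qed.

Lemma support_rename t w : sorted ltn t -> support w = iota 0 (size t) ->
  support (rename_word t w) = t.
Proof.
move=> t_sorted supp_w; rewrite /support indices_rename.
have mem_w i : (i \in indices w) = (i < size t)%N.
  by rewrite -mem_undup -(mem_sort leq) -/(support w) supp_w mem_iota.
have t_leq: sorted leq t by apply: sub_sorted t_sorted => i j; apply: ltnW.
have t_uniq : uniq t := sorted_uniq ltn_trans ltnn t_sorted.
rewrite -[RHS](sorted_sort leq_trans t_leq); apply/perm_sortP.
- exact: leq_total.
- exact: leq_trans.
- exact: anti_leq.
apply: uniq_perm; rewrite ?undup_uniq // => i; rewrite mem_undup.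
apply/mapP/idP => [[k]|/(nthP 0%N)[k lt_k <-]]; last first.
  by exists k; rewrite ?mem_w.
by rewrite mem_w => lt_k ->; apply: mem_nth.
Qed.

(** Increasing renamings are injective on the indices concerned, and the
    pairing depends only on which letters are equal. *)
Lemma form_rename t v w : sorted ltn t -> support v = iota 0 (size t) ->
  support w = iota 0 (size t) ->
  form (rename_word t v) (rename_word t w) = form v w.
Proof.
move=> t_sorted supp_v supp_w.
have t_uniq : uniq t := sorted_uniq ltn_trans ltnn t_sorted.
have lt_t u a : support u = iota 0 (size t) -> a \in letters u ->
    (a.2 < size t)%N.
  move=> supp_u au.
  have : a.2 \in support u by rewrite mem_sort mem_undup map_f.
  by rewrite supp_u mem_iota.
have kronE a p : (a.2 < size t)%N -> (p.2 < size t)%N ->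
    kron (rename_letter t a) (rename_letter t p) = kron a p.
  case: a p => [b i] [b' i'] /= lt_i lt_i'.
  by rewrite /kron !xpair_eqE /= nth_uniq.
move: (fun a => lt_t v a supp_v) (fun a => lt_t w a supp_w).
case: v w {supp_v supp_w} => [[[p q] r] s] [[[a b] c] d] ltv ltw.
rewrite !formE /form_columns !kronE //;
  by [apply: ltv; rewrite !inE eqxx ?orbT
     |apply: ltw; rewrite !inE eqxx ?orbT].
Qed.

Definition unrename (t : seq nat) (w : word) : word :=
  let: (a, b, c, d) := w in let f (x : letter) := (x.1, index x.2 t) in
  (f a, f b, f c, f d).

Lemma unrenameK t w :
  {subset indices w <= t} -> rename_word t (unrename t w) = w.
Proof.
case: w => [[[a b] c] d] sub_wt; rewrite /= /rename_letter /=.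
rewrite !nth_index; last first.
- by apply: sub_wt; rewrite !inE eqxx.
- by apply: sub_wt; rewrite !inE eqxx ?orbT.
- by apply: sub_wt; rewrite !inE eqxx ?orbT.
- by apply: sub_wt; rewrite !inE eqxx ?orbT.
- by case: a b c d {sub_wt} => [? ?] [? ?] [? ?] [? ?].
Qed.

Lemma support_sorted w : sorted ltn (support w).
Proof. by rewrite ltn_sorted_uniq_leq sort_uniq undup_uniq sort_sorted. Qed.

Lemma mem_support w : support w =i indices w.
Proof. by move=> i; rewrite mem_sort mem_undup. Qed.

Lemma size_support w : size (support w) \in ranks.
Proof.
set t := support w.
have le4 : (size t <= 4)%N.
  rewrite size_sort (leq_trans (size_undup _)) //.
  by case: (w) => [[[? ?] ?] ?].
have gt0 : (0 < size t)%N.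
  have : (indices w)`_0 \in t.
    by rewrite mem_support mem_nth //; case: (w) => [[[? ?] ?] ?].
  by case: (t).
by move: (size t) le4 gt0 => [|[|[|[|[|]]]]].
Qed.

(** This reduces statements on all standard words to the finitely many words
    in sst_words. *)
Lemma unrename_sst w : let t := support w in sst w ->
  unrename t w \in sst_words (size t).
Proof.
move=> t; have t_sorted : sorted ltn t := support_sorted w.
have sub_wt : {subset indices w <= t} by move=> i; rewrite mem_support.
have lltE a b : a.2 \in t -> b.2 \in t ->
    llt (a.1, index a.2 t) (b.1, index b.2 t) = llt a b.
  move=> at_ bt_; rewrite /llt /=; case: ifP => // _.
  have ltn_index := sorted_ltn_index ltn_trans t_sorted.
  apply/idP/idP => [|lt_ab]; first exact: ltn_index.
  case: (ltngtP (index a.2 t) (index b.2 t)) => // [lt_ba|eq_ab].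
    by have := ltn_trans lt_ab (ltn_index _ _ bt_ at_ lt_ba); rewrite ltnn.
  by move: lt_ab; rewrite -(nth_index 0%N at_) eq_ab nth_index // ltnn.
have lt_index a : a.2 \in t -> (index a.2 t < size t)%N by rewrite index_mem.
have supp_v : support (unrename t w) = iota 0 (size t).
  apply: (sorted_eq leq_trans anti_leq).
  - exact/sort_sorted/leq_total.
  - exact: iota_sorted.
  apply: uniq_perm; rewrite ?sort_uniq ?undup_uniq ?iota_uniq // => i.
  have -> : support (unrename t w) =i [seq index k t | k <- indices w].
    by case: (w) => [[[a b] c] d] j; rewrite mem_support.
  rewrite mem_iota add0n /=; apply/mapP/idP => [[k wk ->]|lt_i].
    by rewrite index_mem mem_support.
  exists (nth 0%N t i); first by rewrite -mem_support mem_nth.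
  by rewrite index_uniq // sort_uniq undup_uniq.
move=> sst_w; rewrite mem_filter supp_v eqxx andbT.
apply/andP; split.
  move: sst_w sub_wt; case: (w) => [[[a b] c] d] /= sst_w sub_wt.
  by rewrite !lltE // sub_wt // !inE eqxx ?orbT.
move: sub_wt; case: (w) => [[[a b] c] d] sub_wt.
have memL x : x.2 \in t -> (x.1, index x.2 t) \in local_letters (size t).
  move=> tx; apply: allpairs_f; first by case: (x.1).
  by rewrite mem_iota /= index_mem.
have memLL x y : x.2 \in t -> y.2 \in t ->
    ((x.1, index x.2 t), (y.1, index y.2 t))
      \in [seq (x0, y0) | x0 <- local_letters (size t),
                          y0 <- local_letters (size t)].
  by move=> tx ty; apply: allpairs_f; apply: memL.
have := allpairs_f (fun p q : letter * letter => (p.1, p.2, q.1, q.2))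
  (memLL a b _ _) (memLL c d _ _).
by apply; apply: sub_wt; rewrite !inE eqxx ?orbT.
Qed.

(** * The dual family *)

Lemma eval_eq (V : zmodType) (F G : word -> V) q :
  (forall cu, cu \in q -> F cu.2 = G cu.2) -> eval F q = eval G q.
Proof. by move=> eqFG; apply: eq_big_seq => cu /eqFG ->. Qed.

Lemma eval0 (V : zmodType) (F : word -> V) q :
  (forall cu, cu \in q -> F cu.2 = 0) -> eval F q = 0.
Proof.
by move=> F0; rewrite /eval big_seq big1 // => cu /F0 ->; exact: mul0rz.
Qed.

Lemma eval_word (V : zmodType) (F : word -> V) w : eval F [:: (1, w)] = F w.
Proof. exact: big_seq1. Qed.

Lemma eval_flatten (V : zmodType) (F : word -> V) (I : Type) (s : seq I) f :
  eval F (flatten [seq f i | i <- s]) = \sum_(i <- s) eval F (f i).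
Proof. by rewrite /eval big_flatten big_map. Qed.

Lemma pairingE q w : pairing q w = eval (form^~ w) q.
Proof.
elim: q => [|cu q IHq]; first by rewrite /eval big_nil.
by rewrite [RHS]big_cons /= IHq mulrzz mulrC.
Qed.

(** The constant with key (t, r) is template number r on the increasing tuple of
    indices t. *)
Notation key := (seq nat * nat)%type.

Definition constant (k : key) : combination :=
  rename k.1 (nth [::] (templates (size k.1)) k.2).

Definition dual_constant (k : key) : combination :=
  rename k.1 (dual_template (size k.1) k.2).

Definition valid (k : key) : bool :=
  sorted ltn k.1 && (k.2 < size (templates (size k.1)))%N.

Lemma templates_ranks m r : (r < size (templates m))%N -> m \in ranks.
Proof. by move: m => [|[|[|[|[|m]]]]]. Qed.

Lemma support_constant k cu :
  valid k -> cu \in constant k -> support cu.2 = k.1.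
Proof.
case/andP=> k_sorted lt_r /mapP[cu0 q_cu0 ->] /=.
apply: support_rename => //.
have := allP templates_support _ (templates_ranks lt_r).
move/allP/(_ _ (mem_nth [::] lt_r)).
by move/allP/(_ _ q_cu0)/eqP.
Qed.

Lemma support_dual_constant k cu :
  valid k -> cu \in dual_constant k -> support cu.2 = k.1.
Proof.
case/andP=> k_sorted lt_r /mapP[cu0 q_cu0 ->] /=.
apply: support_rename => //.
have := allP dual_template_support _ (templates_ranks lt_r).
move/allP/(_ k.2); rewrite mem_iota lt_r => /(_ isT).
by move/allP/(_ _ q_cu0)/eqP.
Qed.

Lemma eval_der_constant (V : zmodType) (F : word -> V) k :
  curvature F -> valid k -> eval F (der true (constant k)) = 0.
Proof.
move=> curvF /andP[_ lt_r]; rewrite der_rename eval_rename.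
apply: eval_null; first exact: curvature_rename.
have := allP templates_constant _ (templates_ranks lt_r).
by move/allP/(_ _ (mem_nth [::] lt_r)).
Qed.

(** Distinct index sets are orthogonal, and on a common index set this is the
    definition of the inverse Gram matrix. *)
Lemma dual_constantP k k' : valid k -> valid k' ->
  eval (fun v => eval (form v) (constant k')) (dual_constant k)
  = 36 * (k == k')%:R.
Proof.
move=> val_k val_k'; have [eq_t|neq_t] := eqVneq k.1 k'.1; last first.
  rewrite eval0 => [|cu kcu].
    by case: (k =P k') neq_t => [->|_ _]; rewrite ?eqxx ?mulr0.
  apply: eval0 => cu' kcu'; apply: form_support.
  by rewrite (support_dual_constant val_k kcu) (support_constant val_k' kcu').
case: k k' eq_t val_k val_k' => [t r] [_ r'] /= <- val_k val_k'.
have [t_sorted lt_r] := andP val_k; have [_ lt_r'] := andP val_k'.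
rewrite /= in t_sorted lt_r lt_r'; have t_rank := templates_ranks lt_r.
set q := nth [::] (templates (size t)) r'.
have -> : eval (fun v => eval (form v) (constant (t, r')))
      (dual_constant (t, r))
    = eval (fun v => eval (form v) q) (dual_template (size t) r).
  rewrite eval_rename; apply: eval_eq => cu dcu.
  rewrite /= eval_rename; apply: eval_eq => cu' ccu' /=.
  apply: form_rename => //.
    have := allP dual_template_support _ t_rank.
    move/allP/(_ r); rewrite mem_iota lt_r => /(_ isT).
    by move/allP/(_ _ dcu)/eqP.
  have := allP (allP templates_support _ t_rank) _ (mem_nth [::] lt_r').
  by move/allP/(_ _ ccu')/eqP.
have := allP dual_templates _ t_rank.
move/allP/(_ r); rewrite mem_iota lt_r => /(_ isT).
move/allP/(_ r'); rewrite mem_iota lt_r' => /(_ isT)/eqP.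
rewrite xpair_eqE eqxx /= => <-.
under [RHS]eq_bigr do rewrite pairingE.
rewrite /eval; under [LHS]eq_bigr do rewrite mulrz_suml.
rewrite exchange_big /=; apply: eq_bigr => cu _.
rewrite mulr_sumr; apply: eq_bigr => cu' _.
by rewrite !mulrzz; ring.
Qed.

(** The expansion of G in the constants on the index set of v.  The operator
    Delta contributes nothing since G vanishes on its image. *)
Lemma dual_expansion (V : zmodType) (G : word -> V) v :
  curvature G -> (forall w, \sum_(u <- word_der false w) G u = 0) -> sst v ->
  let t := support v in
  G v *+ (12 * 36) = (\sum_(r <- iota 0 (size (templates (size t))))
    eval G (dual_constant (t, r)) *~ eval (form v) (constant (t, r))) *+ 12.
Proof.
move=> curvG G0 sst_v t.
have t_sorted : sorted ltn t := support_sorted v.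
have v0P := unrename_sst sst_v; set v0 := unrename _ v in v0P.
have vE : rename_word t v0 = v.
  by apply: unrenameK => i; rewrite mem_support.
have supp_v0 : support v0 = iota 0 (size t).
  by move: v0P; rewrite mem_filter => /andP[/andP[_ /eqP]].
have t_rank : size t \in ranks := size_support v.
have curvGt := curvature_rename t curvG.
have := eval_null curvGt (allP (allP defect_null _ t_rank) _ v0P).
rewrite /defect !eval_cat !eval_scale eval_der.
rewrite [X in X *~ (-36)]eval0 => [|cu _]; last first.
  have := G0 (rename_word t cu.2); rewrite word_der_rename big_map; exact.
rewrite mul0rz add0r eval_word eval_flatten /= vE.
move/eqP; rewrite addr_eq0 => /eqP; rewrite -sumrN -sumrMnl => GE.
rewrite -[LHS]/(G v *~ (12 * 36)) {}GE; apply: eq_big_seq => r.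
rewrite mem_iota => /andP[_ lt_r]; rewrite eval_scale.
rewrite mulNr mulrNz opprK pairingE (mulrC 12) mulrzA.
rewrite /dual_constant /constant !eval_rename -[_ *~ 12]/(_ *+ 12).
congr (_ *~ _ *+ _).
apply: eval_eq => cu ccu /=; rewrite -[in RHS]vE form_rename //.
  exact: formC.
have := allP (allP templates_support _ t_rank) _ (mem_nth [::] lt_r).
by move/allP/(_ _ ccu)/eqP.
Qed.

(** * Enumeration of the constants *)

Definition xonly (w : word) : bool := ydeg w == 0%N.

(** The elements of B_4 in the x's are listed by words and not by index sets;
    this finds their keys. *)
Definition xkey (w : word) : key :=
  let t := support w in
  (t, index [:: (1 : int, unrename t w)] (templates (size t))).

(** How many of the templates with m indices are elements of B_4 in the x's. *)
Definition xcount (m : nat) : nat := nth 0%N [:: 0; 0; 1; 3; 2]%N m.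

Lemma templates_xonly : all (fun m =>
  all (fun w => xonly w ==>
        (index [:: (1 : int, w)] (templates m) < xcount m)%N)
      (sst_words m)) ranks.
Proof. by vm_compute. Qed.

Lemma xonly_templates : all (fun m =>
  all (fun r => has (fun w =>
      [&& index [:: (1 : int, w)] (templates m) == r, xonly w & sst w])
    (sst_words m)) (iota 0 (xcount m))) ranks.
Proof. by vm_compute. Qed.

Lemma leq_xcount m : (xcount m <= size (templates m))%N.
Proof. by move: m => [|[|[|[|[|m]]]]] //; rewrite /xcount /= nth_nil. Qed.

Lemma xonly_unrename t w : xonly (unrename t w) = xonly w.
Proof. by case: w => [[[a b] c] d]. Qed.

Lemma xkey_lt w : sst w -> xonly w ->
  ((xkey w).2 < xcount (size (xkey w).1))%N.
Proof.
move=> sst_w x_w; have := allP templates_xonly _ (size_support w).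
by move/allP/(_ _ (unrename_sst sst_w)); rewrite xonly_unrename x_w.
Qed.

Lemma constant_xkey w :
  sst w -> xonly w -> constant (xkey w) = [:: (1 : int, w)].
Proof.
move=> sst_w x_w; have := leq_trans (xkey_lt sst_w x_w) (leq_xcount _).
rewrite /constant /= index_mem => tpl_w; rewrite nth_index //=.
by rewrite unrenameK // => i; rewrite mem_support.
Qed.

Lemma valid_xkey w : sst w -> xonly w -> valid (xkey w).
Proof.
move=> sst_w x_w; rewrite /valid support_sorted.
exact: leq_trans (xkey_lt sst_w x_w) (leq_xcount _).
Qed.

Lemma rename_sst t w : sorted ltn t ->
  all (fun a => a.2 < size t)%N (letters w) -> sst w -> sst (rename_word t w).
Proof.
move=> t_sorted lt_t.
have lltE a b : (a.2 < size t)%N -> (b.2 < size t)%N ->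
    llt (rename_letter t a) (rename_letter t b) = llt a b.
  move=> lt_a lt_b; rewrite /llt /=; case: ifP => // _.
  have ltn_t := sorted_ltn_nth ltn_trans 0%N t_sorted.
  case: (ltngtP a.2 b.2) => [lt_ab|lt_ba|->]; last by rewrite ltnn.
    exact: ltn_t.
  by apply/negbTE; rewrite -leqNgt ltnW // ltn_t.
by case: w lt_t => [[[a b] c] d] /and5P[? ? ? ? _] /=; rewrite !lltE.
Qed.

Lemma xkey_surj k : valid k -> (k.2 < xcount (size k.1))%N ->
  exists w, [/\ sst w, xonly w & k = xkey w].
Proof.
case: k => t r /andP[/= t_sorted lt_r] lt_x.
have := allP xonly_templates _ (templates_ranks lt_r).
move/allP/(_ r); rewrite mem_iota => /(_ lt_x)/hasP[w0 w0P].
case/and3P=> /eqP r_w0 x_w0 sst_w0.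
have supp_w0 : support w0 = iota 0 (size t).
  by move: w0P; rewrite mem_filter => /andP[/andP[_ /eqP]].
have supp_w := support_rename t_sorted supp_w0.
have lt_w0 i : i \in indices w0 -> (i < size t)%N.
  by rewrite -mem_support supp_w0 mem_iota.
exists (rename_word t w0); split.
- apply: rename_sst => //; apply/allP=> a w0a.
  by apply: lt_w0; apply: map_f.
- by case: (w0) x_w0 => [[[a b] c] d].
rewrite /xkey supp_w; congr (_, _); rewrite -[LHS]r_w0.
congr (index [:: (_, _)] _).
have t_uniq : uniq t := sorted_uniq ltn_trans ltnn t_sorted.
move: lt_w0; case: (w0) => [[[[? a] [? b]] [? c]] [? d]] lt_w0 /=.
by rewrite !index_uniq //; apply: lt_w0; rewrite !inE /= eqxx ?orbT.
Qed.

Definition xquads (n : nat) : seq ('I_n * 'I_n * 'I_n * 'I_n) :=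
  [seq t : 'I_n * 'I_n * 'I_n * 'I_n <- enum {: 'I_n * 'I_n * 'I_n * 'I_n}
  | let: (i, j, k, l) := t in [&& j < i, i <= l, j <= k & k < l]%N].

Definition xword n (t : 'I_n * 'I_n * 'I_n * 'I_n) : word :=
  let: (i, j, k, l) := t in
  ((false, val i), (false, val j), (false, val k), (false, val l)).

Definition block (ts : seq (seq nat)) (a b : nat) : seq key :=
  [seq (t, r) | t <- ts, r <- iota a b].

Definition incr (m n : nat) : seq (seq nat) :=
  match m with
  | 1 => [seq [:: val i] | i : 'I_n]
  | 2 => [seq (let: (j, i) := t in [:: val j; val i]) | t <- incr2 n]
  | 3 => [seq (let: (j, i, k) := t in [:: val j; val i; val k]) | t <- incr3 n]
  | 4 => [seq (let: (j, i, k, l) := t in [:: val j; val i; val k; val l])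
         | t <- incr4 n]
  | _ => [::]
  end.

Arguments incr : simpl never.

Lemma incr_uniq m n : uniq (incr m n).
Proof.
case: m => [|[|[|[|[|m]]]]] //;
  rewrite /incr map_inj_uniq ?filter_uniq -?enumT ?enum_uniq //.
- by move=> i j [/val_inj].
- by move=> [i j] [i' j'] [/val_inj-> /val_inj->].
- by move=> [[i j] k] [[i' j'] k'] [/val_inj-> /val_inj-> /val_inj->].
- move=> [[[i j] k] l] [[[i' j'] k'] l'].
  by case=> /val_inj-> /val_inj-> /val_inj-> /val_inj->.
Qed.

Lemma mem_incr m n t : m \in ranks ->
  (t \in incr m n) = [&& size t == m, sorted ltn t & all (gtn n) t].
Proof.
rewrite !inE => /or4P[] /eqP->; rewrite /incr; apply/mapP/idP.
- by case=> i _ -> /=; rewrite ltn_ord.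
- case: t => [|a [|b t]] //= /andP[lt_a _].
  by exists (Ordinal lt_a); rewrite ?mem_enum.
- case=> [[i j]]; rewrite mem_filter => /andP[lt_ij _] -> /=.
  by rewrite lt_ij !ltn_ord.
- case: t => [|a [|b [|? ?]]] //= /and4P[lt_ab lt_a lt_b _].
  rewrite andbT in lt_ab.
  exists (Ordinal lt_a, Ordinal lt_b) => //.
  by rewrite mem_filter /= lt_ab mem_enum.
- case=> [[[i j] k]]; rewrite mem_filter => /andP[/andP[lt_ij lt_jk] _] -> /=.
  by rewrite lt_ij lt_jk !ltn_ord.
- case: t => [|a [|b [|c [|? ?]]]] //= /andP[/and3P[lt_ab lt_bc _]].
  case/and4P=> lt_a lt_b lt_c _.
  exists (Ordinal lt_a, Ordinal lt_b, Ordinal lt_c) => //.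
  by rewrite mem_filter /= lt_ab lt_bc mem_enum.
- case=> [[[[i j] k] l]]; rewrite mem_filter.
  case/andP=> /and3P[lt_ij lt_jk lt_kl] _ -> /=.
  by rewrite lt_ij lt_jk lt_kl !ltn_ord.
- case: t => [|a [|b [|c [|d [|? ?]]]]] //= /andP[/and4P[lt_ab lt_bc lt_cd _]].
  case/and5P=> lt_a lt_b lt_c lt_d _.
  exists (Ordinal lt_a, Ordinal lt_b, Ordinal lt_c, Ordinal lt_d) => //.
  by rewrite mem_filter /= lt_ab lt_bc lt_cd mem_enum.
Qed.

(** The position in key_blocks of the block that contains a key. *)
Definition zone (k : key) : nat :=
  match size k.1 with
  | 1 => 4
  | 2 => if (k.2 < 1)%N then 0 else if (k.2 < 4)%N then 1 else 5
  | 3 => if (k.2 < 3)%N then 0 else if (k.2 < 12)%N then 2 else 6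
  | _ => if (k.2 < 2)%N then 0 else if (k.2 < 8)%N then 3 else 7
  end%N.

(** The blocks follow the concatenation that defines the list of constants,
    starting with the elements of B_4 in the x's. *)
Definition key_blocks (n : nat) : seq (seq key) :=
  [:: [seq xkey (xword t) | t <- xquads n];
      block (incr 2 n) 1 3; block (incr 3 n) 3 9; block (incr 4 n) 2 6;
      block (incr 1 n) 0 1;
      block (incr 2 n) 4 4; block (incr 3 n) 12 6; block (incr 4 n) 8 4].

Definition keys (n : nat) : seq key := flatten (key_blocks n).

Lemma uniq_flatten_graded (T : eqType) (f : T -> nat) (s : seq (seq T)) k :
  all uniq s -> (forall i x, x \in nth [::] s i -> f x = (k + i)%N) ->
  uniq (flatten s).
Proof.
elim: s k => //= s0 s IHs k /andP[uniq_s0 uniq_s] fE.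
rewrite cat_uniq uniq_s0 (IHs k.+1) // => [|i x sx]; last first.
  by rewrite (fE i.+1) // addSnnS.
rewrite andbT /=; apply/hasPn => x /flattenP[s1 /(nthP [::])[i _ <-] si_x].
by apply/negP => /(fE 0); rewrite (fE i.+1) //; lia.
Qed.

Lemma block_uniq ts a b : uniq ts -> uniq (block ts a b).
Proof.
move=> ts_uniq; apply: allpairs_uniq; rewrite ?iota_uniq //.
by move=> [? ?] [? ?] _ _ [-> ->].
Qed.

Lemma mem_block ts a b k :
  (k \in block ts a b) = (k.1 \in ts) && (a <= k.2 < a + b)%N.
Proof.
rewrite -mem_iota; case: k => t r; apply/allpairsP/andP => [[[t' r'] /= []]|[]].
  by move=> tst' rr' [-> ->].
by move=> tst rr; exists (t, r).
Qed.

Lemma xquadsP n (w : word) : reflect (exists2 t, t \in xquads n & w = xword t)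
  [&& sst w, xonly w & all (gtn n) (indices w)].
Proof.
apply: (iffP and3P) => [[]|[[[[i j] k] l]]]; last first.
  rewrite mem_filter => /andP[/and4P[lt_ji le_il le_jk lt_kl] _] -> /=.
  by rewrite /llt /= -!leqNgt lt_ji le_il le_jk lt_kl !ltn_ord.
case: w => [[[[[] i] [[] j]] [[] k]] [[] l]] // sst_w _.
case/and5P=> /= lt_i lt_j lt_k lt_l _.
exists (Ordinal lt_i, Ordinal lt_j, Ordinal lt_k, Ordinal lt_l) => //.
by rewrite mem_filter mem_enum andbT /=; rewrite /= /llt /= -!leqNgt in sst_w.
Qed.

Lemma sst_xword n t : t \in xquads n -> sst (xword t) && xonly (xword t).
Proof.
move=> tP; have /and3P[-> -> _] // : [&& sst (xword t), xonly (xword t)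
    & all (gtn n) (indices (xword t))].
by apply/xquadsP; exists t.
Qed.

Lemma keys_uniq n : uniq (keys n).
Proof.
apply: (@uniq_flatten_graded _ zone _ 0); rewrite /key_blocks.
  rewrite /= !block_uniq ?incr_uniq // !andbT map_inj_in_uniq.
    by rewrite filter_uniq ?enum_uniq.
  move=> t t' /sst_xword/andP[s_t x_t] /sst_xword/andP[s_t' x_t'] eq_k.
  have := constant_xkey s_t x_t; rewrite eq_k (constant_xkey s_t' x_t').
  case: t t' {s_t x_t s_t' x_t' eq_k} => [[[i j] k] l] [[[i' j'] k'] l'].
  by case=> /val_inj-> /val_inj-> /val_inj-> /val_inj->.
have zoneP a b m i k : m \in ranks -> k \in block (incr m n) a b ->
    (forall r, (a <= r < a + b)%N -> zone (nseq m 0%N, r) = i) -> zone k = i.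
  move=> m_rank; rewrite mem_block mem_incr //.
  case/andP=> /and3P[/eqP szk _ _] k_r zi.
  by rewrite -(zi k.2) // /zone size_nseq szk.
case=> [|[|[|[|[|[|[|[|i]]]]]]]] k //=; last by rewrite nth_nil.
- case/mapP=> t /sst_xword/andP[s_t x_t] ->; have := xkey_lt s_t x_t.
  rewrite /zone /xcount; have := size_support (xword t); rewrite /=.
  by move: (size _) => [|[|[|[|[|?]]]]] //= _ ->.
all: move/zoneP; apply=> // r; rewrite /zone /=; do ?case: ifP => ?; lia.
Qed.

Lemma mem_keys n k : (k \in keys n) = valid k && all (gtn n) k.1.
Proof.
apply/idP/idP.
  case/flattenP=> s; rewrite inE => /predU1P[->|].
    case/mapP=> t tP ->; have /andP[s_t x_t] := sst_xword tP.
    rewrite valid_xkey //=.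
    have /xquadsP/and3P[_ _] :
      exists2 t', t' \in xquads n & xword t = xword t' by exists t.
    by move/allP=> lt_n; apply/allP=> i; rewrite mem_support => /lt_n.
  have blockP a b m : m \in ranks -> (a + b <= size (templates m))%N ->
      k \in block (incr m n) a b -> valid k && all (gtn n) k.1.
    move=> m_rank le_ab; rewrite mem_block mem_incr // /valid.
    case/andP=> /and3P[/eqP-> -> ->] /andP[_ lt_r]; rewrite andbT /=.
    exact: leq_trans le_ab.
  by rewrite !inE; do ?[case/predU1P=> [->|]]; try move/eqP->; apply: blockP.
case/andP=> k_valid k_n; have [/= k_sorted lt_r] := andP k_valid.
have [lt_x|le_x] := ltnP k.2 (xcount (size k.1)).
  have [w [s_w x_w kE]] := xkey_surj k_valid lt_x.
  apply/flattenP; exists (nth [::] (key_blocks n) 0); first exact: mem_nth.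
  have /xquadsP[t tP wE] : [&& sst w, xonly w & all (gtn n) (indices w)].
    rewrite s_w x_w /=; apply/allP=> i; rewrite -mem_support.
    by move: k_n; rewrite kE => /allP; apply.
  by rewrite kE wE; apply: map_f.
have k_incr : k.1 \in incr (size k.1) n.
  by rewrite mem_incr ?(templates_ranks lt_r) // eqxx k_sorted.
have := templates_ranks lt_r; rewrite !inE.
rewrite /keys /= !mem_cat !mem_block.
move: lt_r le_x k_incr; rewrite /xcount.
move=> + + + /or4P[] /eqP szk; rewrite szk /= => lt_r le_x ->; rewrite /=; lia.
Qed.

(** * Monomials of a metabelian Poisson algebra *)

HB.instance Definition _ (K : fieldType) (P : poissonAlgType K) (a : P) :=
  GRing.isLinear.Build K P P _ (pmul a) (pmul_linearr a).
HB.instance Definition _ (K : fieldType) (P : poissonAlgType K) (a : P) :=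
  GRing.isLinear.Build K P P _ (pbr a) (pbr_linearr a).
(** With values in K^o, because the functionals below are linear maps to a
    module. *)
Definition component (K : fieldType) (k : nat) (a : model K) : K^o := coor a k.

Lemma component_linear (K : fieldType) k : linear (@component K k).
Proof. by move=> c a b; rewrite /component coorD coorZ. Qed.

HB.instance Definition _ (K : fieldType) k :=
  GRing.isLinear.Build K (model K) K^o _ (@component K k) (component_linear k).

Section PoissonTheory.
Variables (K : fieldType) (P : poissonAlgType K).
Implicit Types (a b c : P) (p q r s : letter).

Lemma pbrDl a b c : [< a + b, c >] = [< a, c >] + [< b, c >].
Proof. by rewrite -{1}[a]scale1r (pbr_linearl c 1 a b) scale1r. Qed.

Lemma pbrC a b : [< a, b >] = - [< b, a >].
Proof.
have := pbrxx (a + b); rewrite pbrDl !linearD /= !pbrxx add0r addr0 => /eqP.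
by rewrite addr_eq0 => /eqP.
Qed.

Lemma pbr0l a : [< 0, a >] = 0.
Proof. by rewrite pbrC raddf0 oppr0. Qed.

Lemma pbrNl a b : [< - a, b >] = - [< a, b >].
Proof. by rewrite pbrC raddfN /= [in RHS]pbrC. Qed.

Lemma pmulDl a b c : (a + b) ** c = a ** c + b ** c.
Proof. by rewrite pmulC raddfD /= ![c ** _]pmulC. Qed.

Lemma pmul0l a : 0 ** a = 0.
Proof. by rewrite pmulC raddf0. Qed.

Lemma pmulNl a b : - a ** b = - (a ** b).
Proof. by rewrite pmulC raddfN /= pmulC. Qed.

Definition monomial (z : letter -> P) (w : word) : P :=
  let: (a, b, c, d) := w in [< z a, z b, z c >] ** z d.

(** The identity [[a, b], c.d] = 0 expands by the Leibniz rule to the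
    alternation in c and d.  Exchange of pairs is the classical consequence of
    the other symmetries. *)
Lemma curvature_monomial z : [pchar K] =i pred0 -> metabelian P ->
  curvature (monomial z).
Proof.
move=> charK /metabelianE metaP.
have two0 (v : P) : v + v = 0 -> v = 0.
  move=> v0; have : (2%:R : K) *: v = 0.
    by rewrite scaler_nat mulr2n.
  move/eqP; rewrite scaler_eq0 => /orP[|/eqP //].
  by rewrite ((pcharf0P K).1 charK).
have skew34 p q r s :
    monomial z (p, q, s, r) = - monomial z (p, q, r, s).
  have [[_ _]] := metaP (z p) (z q) (z r) (z s).
  by rewrite pbr_leibniz => /eqP; rewrite addrC addr_eq0 => /eqP.
have skew12 p q r s :
    monomial z (q, p, r, s) = - monomial z (p, q, r, s).
  by rewrite /monomial (pbrC (z q)) pbrNl pmulNl.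
have bianchi p q r s : monomial z (p, q, r, s)
    + monomial z (q, r, p, s) + monomial z (r, p, q, s) = 0.
  by rewrite /monomial -!pmulDl pbr_jacobi pmul0l.
split=> //.
- by move=> p r s; rewrite /monomial pbrxx pbr0l pmul0l.
- by move=> p q r; apply: two0; rewrite {1}skew34 addNr.
move=> p q r s; apply/eqP; rewrite -subr_eq0; apply/eqP/two0.
have := bianchi p q r s; have := bianchi q r s p.
have := bianchi r s p q; have := bianchi s p q r.
(* The Bianchi identities at the four cyclic rotations of p, q, r, s involve
   only six distinct terms, once the alternations are used; adding them with
   signs leaves twice the required difference. *)
rewrite (skew34 q r p s) (skew34 r s p q) (skew12 q s r p).
rewrite (skew12 p s r q) (skew34 p s q r) (skew12 r p s q) (skew34 r p q s).
rewrite (skew12 p s q r) (skew34 p q r s) (skew34 q s r p) !opprK.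
move: (monomial z (p, q, r, s)) (monomial z (q, r, p, s)) => A B.
move: (monomial z (r, p, q, s)) (monomial z (r, s, p, q)) => C A'.
move: (monomial z (p, s, q, r)) (monomial z (q, s, r, p)) => B' C'.
rewrite (addrAC (- B')) (addrAC (- B)) -(addrA A B) -(addrA A' B').
move=> /eqP + /eqP + /eqP + /eqP; rewrite !subr_eq0 !addr_eq0.
move=> /eqP e4 /eqP e3 /eqP e2 /eqP e1.
rewrite addrACA -opprD {1}e3 -e2 {1}e1 -e4 -!opprD; apply/eqP.
by rewrite oppr_eq0 subr_eq0 (addrC B') addrACA (addrC C).
Qed.
End PoissonTheory.

(** * Linear functionals on the free algebra *)

Definition below (n : nat) : pred letter := fun a => (a.2 < n)%N.

Section Functionals.
Variables (K : fieldType) (P : poissonAlgType K) (n : nat).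
Variables (x y : 'I_n -> P).
Hypothesis freeP : free_metabelian (zgen x y).

(** Defined on all letters, with value 0 on the indices that do not occur, so
    that words need not carry bounds. *)
Definition gen (a : letter) : P :=
  if insub a.2 is Some i then if a.1 then y i else x i else 0.

Definition letter_of (i : 'I_(n + n)) : letter :=
  match split i with inl j => (false, val j) | inr j => (true, val j) end.

Lemma gen_letter_of i : gen (letter_of i) = zgen x y i.
Proof.
by rewrite /gen /letter_of /zgen; case: (split i) => j /=; rewrite valK.
Qed.

Lemma letter_of_surj a : below n a -> exists i, a = letter_of i.
Proof.
case: a => [[] i] lt_i.
  by exists (rshift n (Ordinal lt_i)); rewrite /letter_of (unsplitK (inr _)).
by exists (lshift n (Ordinal lt_i)); rewrite /letter_of (unsplitK (inl _)).
Qed.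

(** The values R are compatible with all linear relations between the monomials
    of the free algebra. *)
Definition extends_to (R : word -> K) : Prop :=
  exists T : {linear P -> K^o},
    forall w, all (below n) (letters w) -> T (monomial gen w) = R w.

Lemma extends_sub R1 R2 : extends_to R1 -> extends_to R2 ->
  extends_to (fun w => R1 w - R2 w).
Proof.
by move=> [T1 T1E] [T2 T2E]; exists (T1 \- T2) => w w_n; rewrite -T1E // -T2E.
Qed.

Definition square (f g : letter -> K) (w : word) : K :=
  let: (a, b, c, d) := w in
  (f a * g b - g a * f b) * (f c * g d - g c * f d).

(** Freeness maps the generators to any family of elements of the two-generated
    algebra; the top coordinate of the image is the functional. *)
Lemma extends_square f g : extends_to (square f g).
Proof.
have [_ /(_ (model K) (@model_metabelian K))] := freeP.
pose u (i : 'I_(n + n)) := model_gen (f (letter_of i), g (letter_of i)).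
case/(_ u) => [[h [hM hB] hz] _].
exists (@component K 10 \o h) => [[[[a b] c] d]].
have hgen e : below n e -> h (gen e) = model_gen (f e, g e).
  by case/letter_of_surj => i ->; rewrite gen_letter_of hz.
case/and5P=> a_n b_n c_n d_n _.
by rewrite /= hM !hB !hgen //= /component model_monomial.
Qed.

(** Polarise the square of f /\ g, with f at p and r and with g at q and s.
    The difference with the polarisation that has f at p and s and g at q and r
    is the pairing with (p, q, r, s), in terms of the coordinate functions of
    these letters. *)
Lemma extends_form v : extends_to (fun w => (form v w)%:~R).
Proof.
pose addf (f g : letter -> K) := fun a => f a + g a.
pose polar1 f f' g w :=
  square (addf f f') g w - square f g w - square f' g w.
pose polar2 f f' g g' w :=
  polar1 f f' (addf g g') w - polar1 f f' g w - polar1 f f' g' w.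
have ext1 f f' g : extends_to (polar1 f f' g).
  by apply: extends_sub; [apply: extends_sub|]; exact: extends_square.
have ext2 f f' g g' : extends_to (polar2 f f' g g').
  by apply: extends_sub; [apply: extends_sub|]; exact: ext1.
case: v => [[[p q] r] s]; pose k a b : K := (kron a b)%:~R.
have [T TE] := extends_sub (ext2 (k p) (k r) (k q) (k s))
                           (ext2 (k p) (k s) (k q) (k r)).
exists T => w /TE ->; case: w => [[[a b] c] d].
rewrite formC formE /form_columns /polar2 /polar1 /square /addf /k.
rewrite !(intrD, intrM, rmorphN) /=; ring.
Qed.
End Functionals.

(** * Combinations orthogonal to all words *)

Section Recover.
Variables (K : fieldType) (charK : [pchar K] =i pred0).
Variables (V : lmodType K) (F : word -> V) (curvF : curvature F).

Lemma natr_neq0 k : (k.+1%:R : K) != 0.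
Proof. by rewrite ((pcharf0P K).1 charK). Qed.

(** This is 24 F(w) = F(young w), with the coefficients of young w written as
    pairings.  The list W is any finite set of words that contains those that
    occur. *)
Lemma recover (W : seq word) q : uniq W ->
  (forall cu, cu \in q -> {subset [seq t.2 | t <- young cu.2] <= W}) ->
  eval F q *+ 24 = \sum_(v <- W) F v *~ eval (form v) q.
Proof.
move=> uniq_W qW.
have one cu : cu \in q -> F cu.2 *+ 24 = \sum_(v <- W) F v *~ form v cu.2.
  move=> /qW subW; rewrite -(eval_young _ curvF) /form.
  under [RHS]eq_bigr => v _ do rewrite coefE mulrz_sumr.
  rewrite exchange_big /eval; apply: eq_big_seq => t yt.
  have Wt : t.2 \in W by apply: subW; apply: map_f.
  rewrite (bigD1_seq t.2) //= eqxx mulr1 big1 ?addr0 // => v.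
  by move/negPf=> ->; rewrite mulr0.
rewrite /eval -sumrMnl; under [RHS]eq_bigr do rewrite mulrz_sumr.
rewrite exchange_big; apply: eq_big_seq => cu qcu /=.
rewrite -[_ *+ 24]/(_ *~ 24) mulrzAC -[F _ *~ 24]/(F _ *+ 24) one // mulrz_suml.
by apply: eq_bigr => v _; rewrite mulrzz mulrzA.
Qed.

(** Only words in the letters of the combination occur when it is recovered
    from its pairings, so orthogonality to these suffices. *)
Lemma sum_null (A : pred letter) (Q : seq (K * combination)) :
  (forall cq, cq \in Q -> forall cu, cu \in cq.2 -> all A (letters cu.2)) ->
  (forall v, all A (letters v) ->
     \sum_(cq <- Q) cq.1 * (eval (form v) cq.2)%:~R = 0) ->
  \sum_(cq <- Q) cq.1 *: eval F cq.2 = 0.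
Proof.
move=> QA Q0.
pose W := undup (flatten [seq flatten [seq [seq t.2 | t <- young cu.2]
                                     | cu <- cq.2] | cq <- Q]).
have WA v : v \in W -> all A (letters v).
  rewrite mem_undup => /flattenP[_ /mapP[cq Qcq ->]].
  case/flattenP=> _ /mapP[cu qcu ->] /mapP[t yt ->].
  rewrite (eq_all_r (perm_mem (allP (letters_young cu.2) _ yt))).
  exact: QA qcu.
apply/eqP; rewrite -(inj_eq (@scalerI _ _ _ (natr_neq0 23))) scaler0.
rewrite scaler_nat -sumrMnl; apply/eqP.
transitivity (\sum_(v <- W)
    (\sum_(cq <- Q) cq.1 * (eval (form v) cq.2)%:~R) *: F v).
  under [RHS]eq_bigr do rewrite scaler_suml.
  rewrite exchange_big; apply: eq_big_seq => cq Qcq.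
  rewrite scalerMnr (@recover W) ?undup_uniq //.
    rewrite scaler_sumr; apply: eq_bigr => v _.
    by rewrite -scalerA scaler_int.
  move=> cu qcu v tv; rewrite mem_undup; apply/flattenP.
  exists (flatten [seq [seq t.2 | t <- young cu'.2] | cu' <- cq.2]).
    exact: (map_f (fun cq : K * combination => _) Qcq).
  apply/flattenP; exists [seq t.2 | t <- young cu.2] => //.
  exact: (map_f (fun cu : int * word => _) qcu).
by rewrite big_seq big1 // => v /WA/Q0 ->; rewrite scale0r.
Qed.
End Recover.

(** * Spans of lists *)

Section Span.
Variables (K : fieldType) (V : lmodType K).
Implicit Types (s : seq V) (u v : V).

Lemma in_span0 s : in_span s 0.
Proof.
by exists (fun=> 0); rewrite /lin_comb big1 // => i _; rewrite scale0r.
Qed.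

Lemma in_spanP s (k : K) u v :
  in_span s u -> in_span s v -> in_span s (k *: u + v).
Proof.
move=> [cu ->] [cv ->]; exists (fun i => k * cu i + cv i).
rewrite /lin_comb scaler_sumr -big_split; apply: eq_bigr => i _ /=.
by rewrite scalerDl scalerA.
Qed.

Lemma in_span_mem s v : v \in s -> in_span s v.
Proof.
move=> sv; have lt_i : (index v s < size s)%N by rewrite index_mem.
exists (fun i => (i == Ordinal lt_i)%:R).
rewrite /lin_comb (bigD1 (Ordinal lt_i)) //=.
rewrite eqxx scale1r nth_index // big1 ?addr0 // => i /negPf->.
exact: scale0r.
Qed.

Lemma in_spanB s u v : in_span s u -> in_span s v -> in_span s (u - v).
Proof. by move=> su sv; rewrite addrC -scaleN1r; apply: in_spanP. Qed.

Lemma in_span_sum (I : eqType) (r : seq I) (c : I -> K) (f : I -> V) s :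
  (forall i, i \in r -> in_span s (f i)) ->
  in_span s (\sum_(i <- r) c i *: f i).
Proof.
elim: r => [|i r IHr] sf; first by rewrite big_nil; apply: in_span0.
rewrite big_cons; apply: in_spanP; first by apply: sf; rewrite mem_head.
by apply: IHr => j rj; apply: sf; rewrite in_cons rj orbT.
Qed.
End Span.

(** * The listed constants *)

Section Constants.
Variables (K : fieldType) (P : poissonAlgType K) (n : nat) (x y : 'I_n -> P).
Let z := gen x y.

Lemma gen_x i : z (false, val i) = x i.
Proof. by rewrite /z /gen valK. Qed.

Lemma gen_y i : z (true, val i) = y i.
Proof. by rewrite /z /gen valK. Qed.

Lemma constants_basisE :
  constants_basis x y = [seq eval (monomial z) (constant k) | k <- keys n].
Proof.
have blockE (T : Type) (f : T -> seq nat) (g : T -> seq P) s a b :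
    (forall t, g t
       = [seq eval (monomial z) (constant (f t, r)) | r <- iota a b]) ->
    flatten [seq g t | t <- s]
    = [seq eval (monomial z) (constant k) | k <- block [seq f t | t <- s] a b].
  move=> gE; rewrite /block; elim: s => //= t s IHs.
  by rewrite map_cat -map_comp gE IHs.
have evalS F cu q : eval F (cu :: q) = F cu.2 *~ cu.1 + eval F q :> P.
  exact: big_cons.
have eval_nil F : eval F [::] = 0 :> P by exact: big_nil.
rewrite /keys /key_blocks /= !map_cat /constants_basis cats0.
congr (_ ++ (_ ++ (_ ++ (_ ++ (_ ++ (_ ++ (_ ++ _))))))).
- rewrite /B4 -map_comp; apply/eq_in_map => t /sst_xword/andP[s_t x_t].
  rewrite /= constant_xkey // eval_word.
  by case: t {s_t x_t} => [[[i j] k] l]; rewrite /= !gen_x.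
- apply: blockE => [[j i]].
  rewrite /constant /= !evalS /= !eval_nil !mulr1z !addr0.
  by rewrite /rename_letter /= !gen_x !gen_y.
- apply: blockE => [[[j i] k]].
  rewrite /constant /= !evalS /= !eval_nil !mulrN1z !mulr1z !addr0.
  by rewrite /rename_letter /= !gen_x !gen_y.
- apply: blockE => [[[[j i] k] l]].
  rewrite /constant /= !evalS /= !eval_nil !mulrN1z !mulr1z !addr0 !addrA.
  by rewrite /rename_letter /= !gen_x !gen_y.
- rewrite /constants_y2_1 -[LHS]flatten_map1; apply: blockE => i.
  rewrite /constant /= evalS eval_nil /= addr0 mulr1z.
  by rewrite /rename_letter /= !gen_x !gen_y.
- apply: blockE => [[j i]].
  rewrite /constant /= !evalS /= !eval_nil !mulr1z !addr0 !addrA.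
  by rewrite /rename_letter /= !gen_x !gen_y scaler_nat mulrNz.
- apply: blockE => [[[j i] k]].
  rewrite /constant /= !evalS /= !eval_nil !mulrN1z !mulr1z !addr0 !addrA.
  by rewrite /rename_letter /= !gen_x !gen_y.
- apply: blockE => [[[[j i] k] l]].
  rewrite /constant /= !evalS /= !eval_nil !mulrN1z !mulr1z !addr0 !addrA.
  by rewrite /rename_letter /= !gen_x !gen_y.
Qed.
End Constants.

(** * The derivation on monomials *)

Section Derivation.
Variables (K : fieldType) (P : poissonAlgType K) (n : nat) (x y : 'I_n -> P).
Variable delta : {linear P -> P}.
Hypothesis der_delta : poisson_derivation delta.
Hypothesis delta_y : forall i, delta (y i) = x i.
Hypothesis delta_x : forall i, delta (x i) = 0.
Let z := gen x y.

Lemma delta_gen a : delta (z a) = \sum_(a' <- flip true a) z a'.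
Proof.
rewrite /z /gen /flip; case: a => b i /=; case: insubP => [j _ <-|ge_i].
  by case: b => /=; rewrite ?delta_y ?delta_x ?big_seq1 ?big_nil //= valK.
rewrite linear0; case: b => /=; rewrite ?big_seq1 ?big_nil //=.
by rewrite insubN.
Qed.

Lemma delta_monomial w :
  delta (monomial z w) = \sum_(u <- word_der true w) monomial z u.
Proof.
have [deltaM deltaB] := der_delta.
case: w => [[[a b] c] d]; rewrite /word_der !big_cat !big_map /=.
rewrite deltaM !deltaB !pbrDl !pmulDl -!addrA !delta_gen /flip.
congr (_ + (_ + (_ + _))); case: ifP => _;
  by rewrite ?big_seq1 ?big_nil ?pbr0l ?linear0 ?pbr0l ?pmul0l ?linear0.
Qed.

Lemma delta_eval q :
  delta (eval (monomial z) q) = eval (monomial z) (der true q).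
Proof.
rewrite eval_der raddf_sum; apply: eq_bigr => cu _.
by rewrite raddfMz /= delta_monomial.
Qed.
End Derivation.

(** * The basis of the kernel *)

Lemma curvature_sum (K : pzRingType) (I : Type) (s : seq I) (c : I -> K)
    (G : I -> word -> int) : (forall i, curvature (G i)) ->
  curvature (fun w => \sum_(i <- s) c i * (G i w)%:~R).
Proof.
move=> curvG; split=> *.
- by rewrite big1 // => i _; case: (curvG i) => ->; rewrite ?mulr0.
- by rewrite big1 // => i _; case: (curvG i) => _ ->; rewrite ?mulr0.
- rewrite -sumrN; apply: eq_bigr => i _; case: (curvG i) => _ _ -> _ _ _.
  by rewrite rmorphN mulrN.
- rewrite -sumrN; apply: eq_bigr => i _; case: (curvG i) => _ _ _ -> _ _.
  by rewrite rmorphN mulrN.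
- by apply: eq_bigr => i _; case: (curvG i) => _ _ _ _ -> _.
- rewrite -!big_split big1 // => i _ /=; case: (curvG i) => _ _ _ _ _ bi.
  by rewrite -!mulrDr -!intrD bi mulr0.
Qed.

Lemma curvature_eval_form q : curvature (fun v => eval (form v) q).
Proof.
have formq v : eval (form v) q = \sum_(cu <- q) cu.1 * (form cu.2 v)%:~R.
  by apply: eq_bigr => cu _; rewrite formC intz mulrzz mulrC.
have [a12 a34 s12 s34 pr bi] := curvature_sum q (fun cu => cu.1)
  (fun cu : int * word => form_curvature cu.2).
by split=> *; rewrite !formq.
Qed.

Lemma der_below n b w u :
  all (below n) (letters w) -> u \in word_der b w -> all (below n) (letters u).
Proof.
case: w => [[[p q] r] s] /and5P[Ap Aq Ar As _].
have flip_n a a' : below n a -> a' \in flip b a -> below n a'.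
  by rewrite /flip; case: ifP => // _ Aa; rewrite inE => /eqP->.
rewrite !mem_cat => /or4P[] /mapP[a' fa' ->] /=;
  rewrite ?Ap ?Aq ?Ar ?As ?andbT /=;
  exact: flip_n fa'.
Qed.

Lemma sum_keys (V : zmodType) n v (f : key -> V) : all (below n) (letters v) ->
  (forall k, k \in keys n -> k.1 != support v -> f k = 0) ->
  \sum_(k <- keys n) f k
  = \sum_(r <- iota 0 (size (templates (size (support v))))) f (support v, r).
Proof.
move=> v_n f0; set t := support v.
rewrite (bigID (fun k => k.1 == t)) /= [X in _ + X]big_seq_cond.
rewrite [X in _ + X]big1 => [|k /andP[kn neq_t]]; last exact: f0.
rewrite addr0 -big_filter -[RHS](big_map (fun r => (t, r)) xpredT f).
apply: perm_big.
apply: uniq_perm; rewrite ?filter_uniq ?keys_uniq //.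
  by rewrite map_inj_uniq ?iota_uniq // => r r' [].
case=> t' r; rewrite mem_filter mem_keys /= /valid /=.
apply/and3P/mapP => [[/eqP-> /andP[_ lt_r] _]|[r' + [-> ->]]].
  by exists r; rewrite // mem_iota.
rewrite mem_iota => /andP[_ lt_r']; split=> //.
  by rewrite lt_r' support_sorted.
apply/allP=> i; rewrite mem_support => /mapP[a va ->].
exact: (allP v_n).
Qed.

Section Basis.
Variables (K : fieldType) (P : poissonAlgType K) (n : nat) (x y : 'I_n -> P).
Let z := gen x y.

Definition zquads : seq ('I_(n + n) * 'I_(n + n) * 'I_(n + n) * 'I_(n + n)) :=
  [seq t : 'I_(n + n) * 'I_(n + n) * 'I_(n + n) * 'I_(n + n)
     <- enum {: 'I_(n + n) * 'I_(n + n) * 'I_(n + n) * 'I_(n + n)}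
  | let: (i, j, k, l) := t in [&& j < i, i <= l, j <= k & k < l]%N].

Definition zwords : seq word :=
  [seq (let: (i, j, k, l) := t in
        (letter_of i, letter_of j, letter_of k, letter_of l)) | t <- zquads].

Lemma B4_words : B4 (zgen x y) = [seq monomial z w | w <- zwords].
Proof.
rewrite -map_comp; apply: eq_map => [[[[i j] k] l]].
by rewrite /= /z !gen_letter_of.
Qed.

Lemma below_letter_of i : below n (@letter_of n i).
Proof. by rewrite /below /letter_of; case: (split i) => j /=. Qed.

Lemma llt_letter_of (i j : 'I_(n + n)) :
  llt (letter_of i) (letter_of j) = (i < j)%N.
Proof.
rewrite /letter_of.
case: (split_ordP i) => i' ->; case: (split_ordP j) => j' -> ;
  rewrite /llt /= ?ltn_add2l //.
  by rewrite (leq_trans (ltn_ord i')) // leq_addr.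
by rewrite ltnNge (leq_trans (ltnW (ltn_ord j'))) // leq_addr.
Qed.

Lemma zwords_below w : w \in zwords -> all (below n) (letters w).
Proof. by case/mapP=> [[[[i j] k] l] _ ->]; rewrite /= !below_letter_of. Qed.

Lemma sst_zwords w : sst w -> all (below n) (letters w) -> w \in zwords.
Proof.
case: w => [[[a b] c] d] sst_w /and5P[].
move=> /letter_of_surj[i aE] /letter_of_surj[j bE].
move=> /letter_of_surj[k cE] /letter_of_surj[l dE] _.
apply/mapP; exists (i, j, k, l); last by rewrite aE bE cE dE.
move: sst_w; rewrite aE bE cE dE /= !llt_letter_of -!leqNgt => sst_w.
by rewrite mem_filter sst_w mem_enum.
Qed.

Lemma constant_below k cu : k \in keys n -> cu \in constant k ->
  all (below n) (letters cu.2).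
Proof.
rewrite mem_keys => /andP[val_k lt_k] k_cu; apply/allP=> a cu_a.
have : a.2 \in k.1.
  by rewrite -(support_constant val_k k_cu) mem_support; apply: map_f.
by move/(allP lt_k).
Qed.

Hypothesis charK : [pchar K] =i pred0.
Hypothesis freeP : free_metabelian (zgen x y).

Let curv_z : curvature (monomial z).
Proof. by apply: curvature_monomial => //; case: freeP. Qed.

Let keys_valid k : k \in keys n -> valid k.
Proof. by rewrite mem_keys => /andP[]. Qed.

(** The functionals of extends_form turn a linear relation between the
    constants into one between their pairings with any word, and combining these
    according to a dual constant isolates one coefficient, multiplied by 36. *)
Lemma constants_lin_indep : lin_indep (constants_basis x y).
Proof.
rewrite /lin_indep /lin_comb constants_basisE => c.
set s := map _ _; move=> c0 i.
have sz_s : size s = size (keys n) by rewrite size_map.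
pose k0 : key := ([::], 0%N).
pose k (j : 'I_(size s)) := nth k0 (keys n) j.
have k_keys j : k j \in keys n by rewrite mem_nth // -sz_s.
have s0 v : \sum_(j < size s) c j * (eval (form v) (constant (k j)))%:~R = 0.
  have [T TE] := extends_form freeP v.
  transitivity (T 0); last exact: linear0.
  rewrite -c0 linear_sum; apply: eq_bigr => j _; rewrite linearZ /=.
  congr (_ * _); rewrite (nth_map k0) -?sz_s // -/(k j).
  rewrite /eval !raddf_sum; apply: eq_big_seq => cu k_cu /=.
  by rewrite !raddfMz /= TE //; apply: constant_below k_cu; apply: k_keys.
have val_i := keys_valid (k_keys i).
have : \sum_(j < size s) c j * (eval (fun v => eval (form v) (constant (k j)))
                                     (dual_constant (k i)))%:~R = 0.
  transitivity (\sum_(cu <- dual_constant (k i)) cu.1%:~R *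
     \sum_(j < size s) c j * (eval (form cu.2) (constant (k j)))%:~R).
    under [RHS]eq_bigr do rewrite mulr_sumr.
    rewrite exchange_big; apply: eq_bigr => j _.
    rewrite {1}/eval raddf_sum mulr_sumr; apply: eq_bigr => cu _ /=.
    by rewrite mulrzz intrM; ring.
  by rewrite big1 // => cu _; rewrite s0 mulr0.
rewrite (bigD1 i) //= big1 => [|j neq_ji]; last first.
  rewrite dual_constantP ?(keys_valid (k_keys j)) //.
  rewrite (nth_uniq k0) -?sz_s ?keys_uniq //.
  move: neq_ji; rewrite eq_sym -(inj_eq val_inj) => /negPf ->.
  by rewrite !mulr0.
rewrite dual_constantP // eqxx mulr1 addr0 => /eqP.
by rewrite mulf_eq0 => /orP[/eqP//|]; rewrite (negPf (natr_neq0 charK 35)).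
Qed.

(** B_4 lists the standard words, to which all the others straighten. *)
Lemma span_monomial w : all (below n) (letters w) ->
  in_span (B4 (zgen x y)) (monomial z w).
Proof.
apply: (straighten_in curv_z); first exact: in_span0.
  by move=> u v; apply: in_spanB.
by move=> v sst_v v_n; apply: in_span_mem; rewrite B4_words map_f // sst_zwords.
Qed.

Variable delta : {linear P -> P}.
Hypothesis der_delta : poisson_derivation delta.
Hypothesis delta_y : forall i, delta (y i) = x i.
Hypothesis delta_x : forall i, delta (x i) = 0.

Lemma constants_kernel v : in_span (constants_basis x y) v ->
  in_span (B4 (zgen x y)) v /\ delta v = 0.
Proof.
case=> c ->; rewrite /lin_comb; move: c; rewrite constants_basisE.
set s := map _ _ => c.
have s_ok (i : 'I_(size s)) :
    in_span (B4 (zgen x y)) s`_i /\ delta s`_i = 0.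
  have /mapP[k kn ->] : s`_i \in s by apply: mem_nth.
  split; last first.
    by rewrite (delta_eval der_delta) // eval_der_constant // keys_valid.
  rewrite /eval; under eq_bigr do rewrite -scaler_int.
  apply: in_span_sum => cu k_cu; apply: span_monomial.
  exact: constant_below k_cu.
split; first by apply: in_span_sum => i _; case: (s_ok i).
by rewrite linear_sum big1 // => i _; rewrite linearZ /= (s_ok i).2 scaler0.
Qed.

(** The coefficient of the constant with key k is the value d k of the
    coordinate function G of p on the dual constant, divided by 36. *)
Lemma kernel_constants p : in_span (B4 (zgen x y)) p -> delta p = 0 ->
  in_span (constants_basis x y) p.
Proof.
case=> c pE p0.
have szE : size (B4 (zgen x y)) = size zwords by rewrite B4_words size_map.
pose w0 : word := ((false, 0%N), (false, 0%N), (false, 0%N), (false, 0%N)).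
pose w (t : 'I_(size (B4 (zgen x y)))) := nth w0 zwords t.
have w_words t : w t \in zwords by rewrite mem_nth // -szE.
have {}pE : p = \sum_t c t *: monomial z (w t).
  rewrite pE; apply: eq_bigr => t _; congr (_ *: _).
  by rewrite {1}B4_words (nth_map w0) // -szE.
pose G v := \sum_t c t * (form (w t) v)%:~R.
have curvG : curvature G by apply: curvature_sum => t; apply: form_curvature.
(* G on the image of Delta is the pairing of delta p = 0 with a word. *)
have G0 v : \sum_(u <- word_der false v) G u = 0.
  have [T TE] := extends_form freeP v.
  transitivity (T (delta p)); last by rewrite p0 linear0.
  rewrite pE !linear_sum exchange_big; apply: eq_bigr => t _ /=.
  rewrite !linearZ /= (delta_monomial der_delta) // linear_sum.
  rewrite -mulr_sumr; congr (_ * _); rewrite -rmorph_sum /=.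
  have -> : \sum_(u <- word_der false v) form (w t) u
      = \sum_(u <- word_der true (w t)) form v u.
    by rewrite (form_der false); apply: eq_bigr => u _; rewrite formC.
  rewrite rmorph_sum; apply: eq_big_seq => u wu; rewrite TE //.
  exact: der_below (zwords_below (w_words t)) wu.
pose d k := eval G (dual_constant k) / 36%:R.
(* Q represents p minus its expansion in the constants. *)
pose Q : seq (K * combination) :=
  [seq (c t, [:: (1, w t)]) | t <- index_enum _]
  ++ [seq (- d k, constant k) | k <- keys n].
have neq36 : (36%:R : K) != 0 by exact: (natr_neq0 charK 35).
have Q0 : \sum_(cq <- Q) cq.1 *: eval (monomial z) cq.2 = 0.
  apply: (sum_null charK curv_z (A := below n)).
    move=> cq; rewrite mem_cat => /orP[/mapP[t _ ->]|/mapP[k kn ->]] cu /=.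
      by rewrite inE => /eqP-> /=; apply: zwords_below.
    exact: constant_below.
  apply: (straighten_in (S := fun u => u = 0)) => //.
  - by apply: curvature_sum => cq; apply: curvature_eval_form.
  - by move=> u v -> ->; rewrite subr0.
  move=> v sst_v v_n; rewrite big_cat !big_map /=.
  under eq_bigr do rewrite eval_word formC.
  under [X in _ + X]eq_bigr do rewrite mulNr.
  rewrite sumrN -/(G v); apply/eqP; rewrite subr_eq0; apply/eqP.
  rewrite (sum_keys v_n) => [|k kn neq_t]; last first.
    rewrite [eval _ _]eval0 ?mulr0 // => cu k_cu; apply: form_support.
    by rewrite (support_constant (keys_valid kn) k_cu) eq_sym.
  have := dual_expansion curvG G0 sst_v; rewrite /= => GE.
  apply: (mulIf (mulf_neq0 neq36 (natr_neq0 charK 11))).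
  rewrite -natrM mulr_natr [(36 * 12)%N]mulnC GE mulnC natrM mulrA mulr_natr.
  congr (_ *+ _); rewrite mulr_suml; apply: eq_bigr => r _.
  by rewrite /d mulrAC mulfVK // mulrzr.
move: Q0; rewrite big_cat !big_map /=.
under eq_bigr do rewrite eval_word.
under [X in _ + X]eq_bigr do rewrite scaleNr.
rewrite -pE sumrN => /eqP; rewrite subr_eq0 => /eqP ->.
apply: in_span_sum => k kn; apply: in_span_mem; rewrite constants_basisE.
exact: (map_f (fun k => eval (monomial z) (constant k)) kn).
Qed.
End Basis.

Theorem theorem7p3 (K : fieldType) (charK : [pchar K] =i pred0)
  (n : nat) (n_ge1 : (1 <= n)%N)
  (P : poissonAlgType K) (x y : 'I_n -> P)
  (freeP : free_metabelian (zgen x y))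
  (delta : {linear P -> P}) (der_delta : poisson_derivation delta)
  (delta_y : forall i, delta (y i) = x i)
  (delta_x : forall i, delta (x i) = 0) :
  is_basis (fun p : P => in_span (B4 (zgen x y)) p /\ delta p = 0)
           (constants_basis x y).
Proof.
split; first exact: constants_lin_indep.
move=> p; split=> [[span_p p0]|]; first exact: kernel_constants span_p p0.
exact: constants_kernel.
Qed.
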